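(* Let $\lambda$ be a real number with $0<|\lambda|<\pi/2$ and let $a,b$ be complex numbers. Then the shifted hypergeometric function $z\,{}_2F_1(a,b;a+b+1;z)$ is $\lambda$-spirallike if the following conditions are satisfied: (i) $\operatorname{Re}\big[e^{-i\lambda}ab\big]\ge0$; (ii) $L\ge0$, $N\ge0$ and $LN-M^2\ge0$, where \begin{align*} L&=\operatorname{Re}\big[e^{-i\lambda}ab(2+e^{-2i\lambda})\big],\\ M&=\operatorname{Im}\big[e^{-i\lambda}ab(\bar a+\bar b-2e^{-i\lambda}\cos\lambda)\big],\\ N&=\operatorname{Re}\big[e^{-i\lambda}ab(2\bar a+2\bar b-e^{-2i\lambda}-e^{i\lambda}\bar a\bar b/\cos\lambda)\big]. \end{align*}
   Context: $\mathbb{D}=\{z\in\mathbb{C}:|z|<1\}$. For $a,b,c\in\mathbb{C}$ with $c\ne0,-1,-2,\dots$, the Gaussian hypergeometric function is ${}_2F_1(a,b;c;z)=\sum_{n=0}^\infty\frac{(a)_n(b)_n}{(c)_n n!}z^n$ for $z\in\mathbb{D}$, where $(a)_0=1$ and $(a)_n=a(a+1)\cdots(a+n-1)$. When $ab=0$ the function is ${}_2F_1\equiv1$, so $z\,{}_2F_1(a,b;c;z)\equiv z$. For $\lambda\in(-\pi/2,\pi/2)$, an analytic function $f$ on $\mathbb{D}$ with $f(0)=0$, $f'(0)=1$ is called $\lambda$-spirallike if $\operatorname{Re}\left(e^{-i\lambda}\frac{zf'(z)}{f(z)}\right)>0$ for all $z\in\mathbb{D}$ (the quotient taking the value $1$ at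 $z=0$). *)

(* Defs.v *)
From Stdlib Require Import Reals Lra Lia Psatz Factorial.
From Coquelicot Require Export Coquelicot.

Open Scope C_scope.

(** [Cis t] is exp (i t). *)
Definition Cis (t : R) : C := (cos t, sin t).

(** Componentwise sum of a complex series, in the style of Coquelicot's
    [C_lim]; like [Series] it is total, and [is_C_Series_unique] gives its
    value for every convergent series. *)
Definition C_Series (u : nat -> C) : C :=
  (Series (fun n => Re (u n)), Series (fun n => Im (u n))).

Fixpoint pochhammer (a : C) (n : nat) : C :=
  match n with
  | O => 1
  | S m => pochhammer a m * (a + INR m)
  end.

(** Division by zero gives zero here, so if [c] is 0, -1, -2, ... the terms
    with vanishing (c)_n are dropped.  For a b = 0 the value is always 1. *)
Definition hyp2F1 (a b c z : C) : C :=
  C_Series (fun n =>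
    pochhammer a n * pochhammer b n / (pochhammer c n * INR (fact n)) * z ^ n).

Definition shifted_hyp2F1 (a b c z : C) : C := z * hyp2F1 a b c z.

(** z f'(z) / f(z), extended by 1 at the origin. *)
Definition zf'_over_f (f : C -> C) (z : C) : C :=
  if Ceq_dec z 0 then 1 else z * C_derive f z / f z.

(** Analyticity on the open disk is complex differentiability there
    ([ex_derive] over [C_AbsRing]).  Nonvanishing off the origin is what makes
    the quotient z f'(z) / f(z) meaningful. *)
Definition spirallike (lam : R) (f : C -> C) : Prop :=
  (forall z : C, (Cmod z < 1)%R ->
     @ex_derive C_AbsRing C_NormedModule f z) /\
  f 0 = 0 /\
  C_derive f 0 = 1 /\
  (forall z : C, (Cmod z < 1)%R -> z <> 0 -> f z <> 0) /\
  (forall z : C, (Cmod z < 1)%R -> (0 < Re (Cis (- lam) * zf'_over_f f z))%R).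

Definition coefL (lam : R) (a b : C) : R :=
  Re (Cis (- lam) * (a * b) * (2 + Cis (- (2 * lam)))).

Definition coefM (lam : R) (a b : C) : R :=
  Im (Cis (- lam) * (a * b) *
      (Cconj a + Cconj b - 2 * Cis (- lam) * cos lam)).

Definition coefN (lam : R) (a b : C) : R :=
  Re (Cis (- lam) * (a * b) *
      (2 * Cconj a + 2 * Cconj b - Cis (- (2 * lam))
       - Cis lam * (Cconj a * Cconj b) / cos lam)).

Lemma is_C_Series_unique (u : nat -> C) (l : C) :
  @is_series C_AbsRing C_NormedModule u l -> C_Series u = l.
Proof.
intros H.
assert (Hs : forall n, sum_n u n =
  (sum_n (fun k => Re (u k)) n, sum_n (fun k => Im (u k)) n)).
{ induction n as [|n IH].
  - rewrite !sum_O; apply surjective_pairing.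
  - rewrite !sum_Sn, IH; reflexivity. }
assert (HR : is_series (fun n => Re (u n)) (fst l)).
{ intros P [e He].
  destruct (H (fun y => P (fst y))) as [N HN].
  - exists e; intros y Hy; apply He, (proj1 Hy).
  - exists N; intros n Hn; specialize (HN n Hn); rewrite Hs in HN; exact HN. }
assert (HI : is_series (fun n => Im (u n)) (snd l)).
{ intros P [e He].
  destruct (H (fun y => P (snd y))) as [N HN].
  - exists e; intros y Hy; apply He, (proj2 Hy).
  - exists N; intros n Hn; specialize (HN n Hn); rewrite Hs in HN; exact HN. }
unfold C_Series.
rewrite (is_series_unique _ _ HR), (is_series_unique _ _ HI).
symmetry; apply surjective_pairing.
Qed.

(** For a b <> 0 the positivity conditions already force a + b + 1 to avoid the
    excluded values 0, -1, -2, ..., because coefL + coefN < 0 there. *)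
Lemma parameter_admissible (lam : R) (a b : C) :
  (0 < cos lam)%R -> (0 <= Re (Cis (- lam) * (a * b)))%R ->
  (0 <= coefL lam a b)%R -> (0 <= coefN lam a b)%R -> a * b <> 0 ->
  forall n : nat, a + b + 1 <> - INR n.
Proof.
intros Hc H1 HL HN Hab n Hn.
assert (Hb : b = - INR n - 1 - a) by (rewrite <- Hn; ring).
assert (Hcc : Cconj a + Cconj b = RtoC (- INR n - 1)).
{ rewrite Hb; destruct a as [x y]; apply injective_projections; simpl; ring. }
assert (HNe : (coefN lam a b + coefL lam a b
   = - 2 * INR n * Re (Cis (- lam) * (a * b)) - (Cmod (a * b))^2 / cos lam)%R).
{ assert (Hcos : RtoC (cos lam) <> 0)
    by (intros E; apply RtoC_inj in E; lra).
  assert (Hu : Cis (- lam) * Cis lam = 1).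
  { unfold Cis; rewrite cos_neg, sin_neg; apply injective_projections; simpl.
    - generalize (sin2_cos2 lam); unfold Rsqr; lra.
    - ring. }
  assert (Hm : a * b * (Cconj a * Cconj b) = RtoC ((Cmod (a * b))^2)).
  { rewrite Cmod_mult.
    replace ((Cmod a * Cmod b)^2)%R with ((Cmod a)^2 * (Cmod b)^2)%R by ring.
    unfold Cmod; rewrite !pow2_sqrt by nra.
    destruct a, b; apply injective_projections; simpl; ring. }
  unfold coefN, coefL.
  set (w := Cis (- lam) * (a * b)) in *.
  transitivity (Re (RtoC (- 2 * INR n) * w - RtoC ((Cmod (a * b))^2 / cos lam))).
  - change (Re (w * (2 * Cconj a + 2 * Cconj b - Cis (- (2 * lam))
       - Cis lam * (Cconj a * Cconj b) / cos lam)
       + w * (2 + Cis (- (2 * lam)))) = 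
      Re (RtoC (- 2 * INR n) * w - RtoC ((Cmod (a * b))^2 / cos lam))).
    f_equal.
    rewrite RtoC_div by lra. rewrite <- Hm.
    transitivity (w * (2 * (Cconj a + Cconj b) + 2)
      - (Cis (- lam) * Cis lam) * (a * b * (Cconj a * Cconj b)) / cos lam).
    + unfold w; field; exact Hcos.
    + rewrite Hcc, Hu.
      replace (RtoC (- 2 * INR n)) with (2 * RtoC (- INR n - 1) + 2)
        by (apply injective_projections; simpl; ring).
      field; exact Hcos.
  - destruct w; simpl; ring. }
assert (Hp : (0 < Cmod (a * b))%R) by (apply Cmod_gt_0; exact Hab).
assert (Hq : (0 < Cmod (a * b) ^ 2 / cos lam)%R)
  by (apply Rdiv_lt_0_compat; [apply pow_lt|]; assumption).
generalize (pos_INR n); intros Hi.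
assert (0 <= INR n * Re (Cis (- lam) * (a * b)))%R by (apply Rmult_le_pos; assumption).
lra.
Qed.

(* Main.v *)
(** Write f = z F and w = e^(-i lam), and let psi = w F' / (2 cos lam F + w z F'),
    so that Re (w z f'/f) > 0 exactly when |z psi| < 1 and the denominator does
    not vanish.  At a point z0 of least modulus where positivity fails, the
    maximum principle for psi gives |psi| <= 1/|z0| on the disk of radius |z0|,
    with equality at z0; hence z0 psi'(z0)/psi(z0) is real and nonnegative
    (Jack's lemma).  A simple zero of F at z0 contradicts this directly, and a
    double zero is excluded by Gronwall's inequality.  Otherwise q = z F'/F
    satisfies (1 - z) (z q' + q^2 + (a + b) q) = a b z, which follows from the
    hypergeometric equation (1 - z) (z F'' + c F') = a b F with c = a + b + 1.
    At z0 this turns Re (z0/(1 - z0)) > -1/2 into the negativity of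
    L x^2 - 2 M x + N + (nonnegative term) for some real x, contradicting the
    hypotheses on L, M and N. *)

(* [psi] comes from a Cayley transform. With q = z F'/F, the quantity p = e^(-i lam) z f'/f equals w
   (1 + q) and takes the value w at the origin; the map (p - w)/(p + conj w) carries the right
   half-plane to the unit disk and w to 0. Since w + conj w = 2 cos lam, it reads w q/(2 cos lam + w
   q) = z [psi]. The obstacle is that F is not known in advance to be free of zeros, so p and q
   cannot be taken for granted. Every step up to [F_z0] is therefore phrased with the numerator [N],
   the denominator [D] and the form |F|^2 Re p, whose positivity contains the absence of zeros. No
   integral formula is used: derivatives come from termwise differentiation of the series, and the
   maximum principle from the second-derivative test along real lines. *)
Require Import Defs.
From Stdlib Require Import Reals Lra Lia Psatz Factorial ClassicalEpsilon.
From Coquelicot Require Import Coquelicot.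

Open Scope C_scope.

(** * Complex power series *)

Definition C_sum (a : nat -> C) (z : C) : C := C_Series (fun n => a n * z ^ n).

Definition C_sum_derive (a : nat -> C) (n : nat) : C := INR (S n) * a (S n).

(** Radius of convergence at least 1, put as absolute convergence on smaller circles so that real
    comparison tests and [CV_radius] apply to the moduli. *)
Definition unit_radius (a : nat -> C) : Prop :=
  forall r : R, (0 <= r < 1)%R -> ex_series (fun n => (Cmod (a n) * r ^ n)%R).

(** The remainder is O(h^2) instead of o(h): power series satisfy this, and the
    product and quotient rules become elementary estimates. *)
Definition quad_deriv (f : C -> C) (z l : C) : Prop :=
  exists K d : R, (0 < d)%R /\ forall h : C, (Cmod h < d)%R ->
    (Cmod (f (z + h) - f z - l * h)%C <= K * Cmod h ^ 2)%R.

Lemma Cmod_le_Re_Im (z : C) : (Cmod z <= Rabs (Re z) + Rabs (Im z))%R.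
Proof.
replace z with (RtoC (Re z) + Ci * RtoC (Im z)) at 1
  by (destruct z; apply injective_projections; simpl; ring).
eapply Rle_trans; [apply Cmod_triangle|].
rewrite Cmod_mult, Cmod_Ci, !Cmod_R; lra.
Qed.

Lemma im_le_Cmod (z : C) : (Rabs (Im z) <= Cmod z)%R.
Proof.
eapply Rle_trans; [|apply Rmax_Cmod]; apply Rmax_r.
Qed.

Lemma ex_series_Re (u : nat -> C) (v : nat -> R) :
  (forall n, (Cmod (u n) <= v n)%R) -> ex_series v -> ex_series (fun n => Re (u n)).
Proof.
intros H Hv; apply (ex_series_le (K := R_AbsRing) (V := R_CompleteNormedModule) _ v); [|exact Hv].
intros n; eapply Rle_trans; [apply (re_le_Cmod (u n))|apply H].
Qed.

Lemma ex_series_Im (u : nat -> C) (v : nat -> R) :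
  (forall n, (Cmod (u n) <= v n)%R) -> ex_series v -> ex_series (fun n => Im (u n)).
Proof.
intros H Hv; apply (ex_series_le (K := R_AbsRing) (V := R_CompleteNormedModule) _ v); [|exact Hv].
intros n; eapply Rle_trans; [apply (im_le_Cmod (u n))|apply H].
Qed.

Lemma C_Series_ext (u v : nat -> C) : (forall n, u n = v n) -> C_Series u = C_Series v.
Proof.
intros H; unfold C_Series; f_equal; apply Series_ext; intros n; rewrite H; reflexivity.
Qed.

Section AbsConv.

Variables (u v : nat -> C).
Hypotheses (Hu : ex_series (fun n => Cmod (u n))) (Hv : ex_series (fun n => Cmod (v n))).

Let uR := ex_series_Re u _ (fun n => Rle_refl _) Hu.
Let uI := ex_series_Im u _ (fun n => Rle_refl _) Hu.
Let vR := ex_series_Re v _ (fun n => Rle_refl _) Hv.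
Let vI := ex_series_Im v _ (fun n => Rle_refl _) Hv.

Lemma C_Series_plus : C_Series (fun n => u n + v n) = C_Series u + C_Series v.
Proof.
unfold C_Series; apply injective_projections; simpl.
- apply Series_plus; assumption.
- apply Series_plus; assumption.
Qed.

Lemma C_Series_scal (k : C) : C_Series (fun n => k * u n) = k * C_Series u.
Proof.
unfold C_Series; apply injective_projections; simpl; fold (Re k) (Im k).
- rewrite <- !Series_scal_l, <- Series_minus
    by (apply @ex_series_scal_l; assumption); reflexivity.
- rewrite <- !Series_scal_l, <- Series_plus
    by (apply @ex_series_scal_l; assumption); reflexivity.
Qed.

Lemma C_Series_incr_1 : C_Series u = u 0%nat + C_Series (fun n => u (S n)).
Proof.
unfold C_Series; apply injective_projections; simpl.
- apply (Series_incr_1 (fun n => Re (u n))); assumption.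
- apply (Series_incr_1 (fun n => Im (u n))); assumption.
Qed.

End AbsConv.

(** The factor 2 is the price of estimating real and imaginary parts separately; in [quad_deriv] any
    constant serves. *)
Lemma C_Series_bound (u : nat -> C) (v : nat -> R) :
  (forall n, (Cmod (u n) <= v n)%R) -> ex_series v ->
  (Cmod (C_Series u) <= 2 * Series v)%R.
Proof.
intros H Hv.
assert (Hb : forall w : nat -> R, (forall n, (Rabs (w n) <= v n)%R) ->
  (Rabs (Series w) <= Series v)%R).
{ intros w Hw.
  assert (Hs : ex_series (fun n => Rabs (w n))).
  { apply (ex_series_le (K := R_AbsRing) (V := R_CompleteNormedModule) _ v); [|exact Hv].
    intros n; change (Rabs (Rabs (w n)) <= v n)%R; rewrite Rabs_Rabsolu; apply Hw. }
  eapply Rle_trans; [apply Series_Rabs, Hs|].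
  apply Series_le; [|exact Hv].
  intros n; split; [apply Rabs_pos|apply Hw]. }
eapply Rle_trans; [apply Cmod_le_Re_Im|].
assert (H1 := Hb (fun n => Re (u n)) (fun n => Rle_trans _ _ _ (re_le_Cmod _) (H n))).
assert (H2 := Hb (fun n => Im (u n)) (fun n => Rle_trans _ _ _ (im_le_Cmod _) (H n))).
unfold C_Series; simpl; lra.
Qed.

Lemma unit_radius_abs (a : nat -> C) (z : C) :
  unit_radius a -> (Cmod z < 1)%R -> ex_series (fun n => Cmod (a n * z ^ n)).
Proof.
intros Ha Hz.
eapply ex_series_ext; [|apply (Ha (Cmod z)); split; [apply Cmod_ge_0|exact Hz]].
intros n; simpl; rewrite Cmod_mult, Cmod_pow; reflexivity.
Qed.

(** The moduli form a real power series of radius at least s = (1 + r)/2 > r, and formal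
    differentiation preserves a real radius of convergence. *)
Lemma unit_radius_derive (a : nat -> C) : unit_radius a -> unit_radius (C_sum_derive a).
Proof.
intros Ha r Hr.
set (s := ((1 + r) / 2)%R).
assert (Hle : Rbar_le s (CV_radius (fun n => Cmod (a n)))).
{ unfold CV_radius; destruct (Lub_Rbar_correct (CV_disk (fun n => Cmod (a n)))) as [H _].
  apply H; unfold CV_disk.
  eapply ex_series_ext; [|apply (Ha s); unfold s; lra].
  intros n; simpl; rewrite Rabs_right; [reflexivity|].
  apply Rle_ge, Rmult_le_pos; [apply Cmod_ge_0|apply pow_le; unfold s; lra]. }
rewrite <- CV_radius_derive in Hle.
assert (Hlt : Rbar_lt (Rabs r) (CV_radius (PS_derive (fun n => Cmod (a n))))).
{ eapply Rbar_lt_le_trans; [|exact Hle]; simpl; rewrite Rabs_right; unfold s; lra. }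
eapply ex_series_ext; [|apply (CV_disk_inside _ _ Hlt)].
intros n; unfold PS_derive, C_sum_derive.
rewrite Rabs_right.
- rewrite Cmod_mult, Cmod_R, Rabs_right by (apply Rle_ge, pos_INR); reflexivity.
- apply Rle_ge, Rmult_le_pos; [apply Rmult_le_pos|].
  + apply pos_INR.
  + apply Cmod_ge_0.
  + apply pow_le; lra.
Qed.

(** Induction: if E_n is the remainder, the next one is (z + h) E_n + (n + 1) h^2 z^n. The constant
    is that of the second derivative, so that the bounds sum to the majorant of the twice
    differentiated series. At n = 0 the truncated exponent is harmless, since [INR n] vanishes. *)
Lemma pow_taylor_bound (z h : C) (r : R) (n : nat) :
  (Cmod z <= r)%R -> (Cmod (z + h) <= r)%R ->
  (Cmod ((z + h) ^ S n - z ^ S n - INR (S n) * (h * z ^ n))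
   <= INR (S n) * INR n * r ^ (n - 1) * Cmod h ^ 2)%R.
Proof.
intros Hz Hzh.
assert (Hr : (0 <= r)%R) by (generalize (Cmod_ge_0 z); lra).
induction n as [|n IH].
- replace ((z + h) ^ 1 - z ^ 1 - INR 1 * (h * z ^ 0)) with (RtoC 0)
    by (simpl INR; simpl Cpow; ring).
  rewrite Cmod_0; simpl; lra.
- replace ((z + h) ^ S (S n) - z ^ S (S n) - INR (S (S n)) * (h * z ^ S n)) with
    ((z + h) * ((z + h) ^ S n - z ^ S n - INR (S n) * (h * z ^ n))
      + INR (S n) * (h ^ 2 * z ^ n)).
  2:{ rewrite (S_INR (S n)), RtoC_plus; simpl Cpow; ring. }
  eapply Rle_trans; [apply Cmod_triangle|].
  rewrite !Cmod_mult, !Cmod_pow, Cmod_R, Rabs_right by (apply Rle_ge, pos_INR).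
  assert (H1 : (Cmod (z + h) * Cmod ((z + h) ^ S n - z ^ S n - INR (S n) * (h * z ^ n))
    <= r * (INR (S n) * INR n * r ^ (n - 1) * Cmod h ^ 2))%R).
  { apply Rmult_le_compat; auto using Cmod_ge_0. }
  assert (H2 : (r * (INR (S n) * INR n * r ^ (n - 1) * Cmod h ^ 2) =
     INR (S n) * INR n * r ^ n * Cmod h ^ 2)%R).
  { destruct n; [simpl; ring|].
    replace (S n - 1)%nat with n by lia; simpl pow; ring. }
  assert (H3 : (Cmod z ^ n <= r ^ n)%R) by (apply pow_incr; split; [apply Cmod_ge_0|auto]).
  assert (H4 : (INR (S n) * (Cmod h ^ 2 * Cmod z ^ n) <= INR (S n) * (Cmod h ^ 2 * r ^ n))%R).
  { apply Rmult_le_compat_l; [apply pos_INR|].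
    apply Rmult_le_compat_l; [apply pow2_ge_0|auto]. }
  replace (S n - 1)%nat with n by lia.
  assert (H5 : (0 <= INR (S n) * (Cmod h ^ 2 * r ^ n))%R).
  { apply Rmult_le_pos; [apply pos_INR|apply Rmult_le_pos; [apply pow2_ge_0|apply pow_le; auto]]. }
  rewrite H2 in H1; clear H2 H3.
  replace (INR (S (S n)) * INR (S n) * r ^ n * Cmod h ^ 2)%R with
    (INR (S n) * INR n * r ^ n * Cmod h ^ 2 + 2 * (INR (S n) * (Cmod h ^ 2 * r ^ n)))%R
    by (rewrite !S_INR; ring).
  lra.
Qed.

Lemma C_sum_quad_deriv (a : nat -> C) (z : C) :
  unit_radius a -> (Cmod z < 1)%R ->
  quad_deriv (C_sum a) z (C_sum (C_sum_derive a) z).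
Proof.
intros Ha Hz.
set (r := ((1 + Cmod z) / 2)%R).
assert (Hz0 := Cmod_ge_0 z).
assert (Hr : (0 <= r < 1)%R) by (unfold r; lra).
assert (H2 := unit_radius_derive _ (unit_radius_derive _ Ha) r Hr).
(* The factor 2 is that of [C_Series_bound]; |h| < (1 - |z|)/2 keeps z + h in the disk of radius
   r. *)
exists (2 * Series (fun n => Cmod (C_sum_derive (C_sum_derive a) n) * r ^ n))%R,
  ((1 - Cmod z) / 2)%R.
split; [lra|]; intros h Hh.
assert (Hzh : (Cmod (z + h) <= r)%R).
{ eapply Rle_trans; [apply Cmod_triangle|]; unfold r; lra. }
assert (Ez := unit_radius_abs a z Ha Hz).
assert (Ezh := unit_radius_abs a (z + h) Ha (Rle_lt_trans _ _ _ Hzh (proj2 Hr))).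
assert (Ed := unit_radius_abs _ z (unit_radius_derive _ Ha) Hz).
assert (shift : forall w, ex_series (fun n => Cmod (a n * w ^ n)) ->
  ex_series (fun n => Cmod (a (S n) * w ^ S n))).
{ intros w Hw.
  apply (proj1 (ex_series_incr_1 (fun n => Cmod (a n * w ^ n)))); exact Hw. }
set (E := fun n : nat => a (S n) * ((z + h) ^ S n - z ^ S n - INR (S n) * (h * z ^ n))).
assert (EscalC : forall (k : C) (u : nat -> C), ex_series (fun n => Cmod (u n)) ->
   ex_series (fun n => Cmod (k * u n))).
{ intros k u Hu; eapply ex_series_ext; [|apply (ex_series_scal_l (Cmod k)), Hu].
  intros n; simpl; rewrite Cmod_mult; reflexivity. }
assert (EplusC : forall (u v : nat -> C), ex_series (fun n => Cmod (u n)) ->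
   ex_series (fun n => Cmod (v n)) -> ex_series (fun n => Cmod (u n + v n))).
{ intros u v Hu Hv.
  apply (ex_series_le (K := R_AbsRing) (V := R_CompleteNormedModule) _
     (fun n => (Cmod (u n) + Cmod (v n))%R)).
  - intros n; change (Rabs (Cmod (u n + v n)) <= Cmod (u n) + Cmod (v n))%R.
    rewrite Rabs_right by (apply Rle_ge, Cmod_ge_0); apply Cmod_triangle.
  - apply (ex_series_plus (V := R_NormedModule)); assumption. }
assert (HE : C_sum a (z + h) - C_sum a z - C_sum (C_sum_derive a) z * h = C_Series E).
{ assert (Heq : forall n, E n = a (S n) * (z + h) ^ S n +
    ((- (1)) * (a (S n) * z ^ S n) + (- h) * (C_sum_derive a n * z ^ n))).
  { intros n; unfold E, C_sum_derive; ring. }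
  rewrite (C_Series_ext _ _ Heq).
  rewrite C_Series_plus, C_Series_plus, C_Series_scal, C_Series_scal; auto.
  unfold C_sum at 1 2.
  rewrite (C_Series_incr_1 _ Ez), (C_Series_incr_1 _ Ezh).
  unfold C_sum; simpl Cpow; ring. }
rewrite HE.
assert (HE1 : ex_series (fun n => Cmod (E n))).
{ apply (ex_series_ext (fun n => Cmod (a (S n) * (z + h) ^ S n +
    ((- (1)) * (a (S n) * z ^ S n) + (- h) * (C_sum_derive a n * z ^ n))))).
  - intros n; f_equal; unfold E, C_sum_derive; ring.
  - auto. }
(* The entry of [E] at index 0 is the remainder of the linear term and vanishes; dropping it aligns
   [E] with the twice differentiated series. *)
rewrite (C_Series_incr_1 _ HE1).
replace (E 0%nat) with (RtoC 0) by (unfold E; simpl INR; simpl Cpow; ring).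
rewrite Cplus_0_l.
rewrite Rmult_assoc, <- Series_scal_r.
apply C_Series_bound.
- intros n; unfold E, C_sum_derive.
  rewrite !Cmod_mult, !Cmod_R, !Rabs_right by (apply Rle_ge, pos_INR).
  assert (Hp := pow_taylor_bound z h r (S n)).
  replace (S n - 1)%nat with n in Hp by lia.
  assert (Hzr : (Cmod z <= r)%R) by (unfold r; lra).
  specialize (Hp Hzr Hzh).
  replace (INR (S n) * (INR (S (S n)) * Cmod (a (S (S n)))) * r ^ n * Cmod h ^ 2)%R
   with (Cmod (a (S (S n))) * (INR (S (S n)) * INR (S n) * r ^ n * Cmod h ^ 2))%R by ring.
  apply Rmult_le_compat_l; [apply Cmod_ge_0|exact Hp].
- eapply ex_series_ext; [|apply (ex_series_scal_r (Cmod h ^ 2)), H2].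
  intros n; reflexivity.
Qed.

(** * The hypergeometric series and its differential equation *)

Lemma RtoC_neq_0 (r : R) : r <> 0%R -> RtoC r <> 0.
Proof. intros H E; apply H, RtoC_inj, E. Qed.

Lemma unit_radius_ratio (u : nat -> C) :
  (forall R : R, (1 < R)%R -> exists N, forall n, (N <= n)%nat ->
     (Cmod (u (S n)) <= R * Cmod (u n))%R) -> unit_radius u.
Proof.
intros H r Hr.
(* The ratio bound 2/(1 + r) > 1 is chosen so that q, its product with r, stays below 1. *)
set (q := (2 * r / (1 + r))%R).
assert (Hq : (0 <= q < 1)%R).
{ unfold q; split.
  - apply Rmult_le_pos; [lra|]; left; apply Rinv_0_lt_compat; lra.
  - apply Rmult_lt_reg_r with (1 + r)%R; [lra|]; field_simplify; lra. }
destruct (H (2 / (1 + r))%R) as [N HN].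
{ apply Rmult_lt_reg_r with (1 + r)%R; [lra|]; field_simplify; lra. }
apply (ex_series_incr_n _ N).
apply (ex_series_le (K := R_AbsRing) (V := R_CompleteNormedModule) _
  (fun k => (Cmod (u N) * r ^ N * q ^ k)%R)).
- intros k; change (Rabs (Cmod (u (N + k)%nat) * r ^ (N + k)) <= Cmod (u N) * r ^ N * q ^ k)%R.
  rewrite Rabs_right
    by (apply Rle_ge, Rmult_le_pos; [apply Cmod_ge_0|apply pow_le; lra]).
  induction k as [|k IH].
  + rewrite Nat.add_0_r; simpl; lra.
  + rewrite <- plus_n_Sm; simpl pow.
    specialize (HN (N + k)%nat ltac:(lia)).
    assert (Hp : (0 <= r ^ (N + k))%R) by (apply pow_le; lra).
    apply Rle_trans with (2 / (1 + r) * Cmod (u (N + k)%nat) * (r * r ^ (N + k)))%R.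
    * apply Rmult_le_compat_r; [apply Rmult_le_pos; lra|exact HN].
    * replace (2 / (1 + r) * Cmod (u (N + k)%nat) * (r * r ^ (N + k)))%R with
       (q * (Cmod (u (N + k)%nat) * r ^ (N + k)))%R by (unfold q; field; lra).
      replace (Cmod (u N) * r ^ N * (q * q ^ k))%R with
       (q * (Cmod (u N) * r ^ N * q ^ k))%R by ring.
      apply Rmult_le_compat_l; lra.
- eapply ex_series_ext; [|apply (ex_series_scal_l (Cmod (u N) * r ^ N)%R), (ex_series_geom q)].
  + intros n; reflexivity.
  + rewrite Rabs_right; lra.
Qed.

Definition hyp_coef (a b c : C) (n : nat) : C :=
  pochhammer a n * pochhammer b n / (pochhammer c n * INR (fact n)).

Lemma pochhammer_neq_0 (c : C) (n : nat) :
  (forall n : nat, c <> - INR n) -> pochhammer c n <> 0.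
Proof.
intros Hc; induction n as [|n IH]; simpl pochhammer.
- apply RtoC_neq_0; lra.
- apply Cmult_neq_0; [exact IH|].
  intros E; apply (Hc n); rewrite <- (Cplus_0_r (- INR n)), <- E; ring.
Qed.

Lemma hyp_coef_rec (a b c : C) (n : nat) :
  (forall n : nat, c <> - INR n) ->
  INR (S n) * (c + INR n) * hyp_coef a b c (S n) =
  (a + INR n) * (b + INR n) * hyp_coef a b c n.
Proof.
intros Hc.
assert (H1 := pochhammer_neq_0 c (S n) Hc).
assert (H2 := pochhammer_neq_0 c n Hc).
unfold hyp_coef.
assert (Hf : RtoC (INR (fact n)) <> 0) by (apply RtoC_neq_0, INR_fact_neq_0).
assert (HS : RtoC (INR (S n)) <> 0) by (apply RtoC_neq_0, not_0_INR; lia).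
change (fact (S n)) with (S n * fact n)%nat; rewrite mult_INR, RtoC_mult.
simpl pochhammer in *.
assert (H3 : c + INR n <> 0) by (intros E; apply H1; rewrite E; ring).
field; repeat split; assumption.
Qed.

Lemma hyp_coef_unit_radius (a b c : C) :
  (forall n : nat, c <> - INR n) -> unit_radius (hyp_coef a b c).
Proof.
intros Hc; apply unit_radius_ratio; intros R HR.
assert (Ha := Cmod_ge_0 a); assert (Hb := Cmod_ge_0 b); assert (Hg := Cmod_ge_0 c).
(* For n > N the term n^2 (R - 1) outweighs the lower-order terms in (|a| + n)(|b| + n) <= R n (n -
   |c|), where |a||b| is first enlarged to n |a||b|. *)
destruct (nfloor_ex ((Cmod a + Cmod b + Cmod a * Cmod b + R * Cmod c) / (R - 1))) as [N [_ HN]].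
{ apply Rmult_le_pos; [|left; apply Rinv_0_lt_compat; lra].
  assert (0 <= Cmod a * Cmod b)%R by (apply Rmult_le_pos; assumption).
  assert (0 <= R * Cmod c)%R by (apply Rmult_le_pos; lra). lra. }
exists (S N); intros n Hn.
assert (Hrec := hyp_coef_rec a b c n Hc).
assert (Hn1 : (INR N + 1 <= INR n)%R) by (rewrite <- S_INR; apply le_INR; exact Hn).
assert (HN0 := pos_INR N).
assert (Hk : (Cmod a + Cmod b + Cmod a * Cmod b + R * Cmod c <= INR n * (R - 1))%R).
{ apply Rmult_le_reg_r with (/ (R - 1))%R; [apply Rinv_0_lt_compat; lra|].
  rewrite Rmult_assoc, Rinv_r by lra. unfold Rdiv in HN; lra. }
apply (f_equal Cmod) in Hrec; rewrite !Cmod_mult, Cmod_R, Rabs_right in Hrec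
  by (apply Rle_ge, pos_INR).
assert (G1 : (INR n - Cmod c <= Cmod (c + INR n))%R).
{ assert (Ht := Cmod_triangle (c + INR n) (- c)).
  replace (c + INR n + - c) with (RtoC (INR n)) in Ht by ring.
  rewrite Cmod_opp, Cmod_R, Rabs_right in Ht by (apply Rle_ge, pos_INR); lra. }
assert (G2 : forall x : C, (Cmod (x + INR n) <= Cmod x + INR n)%R).
{ intros x; eapply Rle_trans; [apply Cmod_triangle|].
  rewrite Cmod_R, Rabs_right by (apply Rle_ge, pos_INR); lra. }
assert (Hu := Cmod_ge_0 (hyp_coef a b c n)).
assert (Hv := Cmod_ge_0 (hyp_coef a b c (S n))).
assert (Hcn : (0 < INR n - Cmod c)%R) by nra.
assert (Hprod : (0 < INR (S n) * (INR n - Cmod c))%R)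
  by (apply Rmult_lt_0_compat; [apply lt_0_INR; lia|exact Hcn]).
apply Rmult_le_reg_l with (1 := Hprod).
apply Rle_trans with (INR (S n) * Cmod (c + INR n) * Cmod (hyp_coef a b c (S n)))%R.
{ apply Rmult_le_compat_r; [exact Hv|].
  apply Rmult_le_compat_l; [apply pos_INR|exact G1]. }
rewrite Hrec.
apply Rle_trans with ((Cmod a + INR n) * (Cmod b + INR n) * Cmod (hyp_coef a b c n))%R.
{ apply Rmult_le_compat_r; [exact Hu|].
  apply Rmult_le_compat; auto using Cmod_ge_0. }
replace (INR (S n) * (INR n - Cmod c) * (R * Cmod (hyp_coef a b c n)))%R with
  (INR (S n) * (INR n - Cmod c) * R * Cmod (hyp_coef a b c n))%R by ring.
apply Rmult_le_compat_r; [exact Hu|].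
rewrite S_INR.
assert (0 <= Cmod a * Cmod b)%R by (apply Rmult_le_pos; assumption).
assert (0 <= INR n * R * Cmod c)%R by (repeat apply Rmult_le_pos; lra).
apply Rle_trans with (INR n * (INR n - Cmod c) * R)%R.
2:{ apply Rmult_le_compat_r; [lra|]. apply Rmult_le_compat_r; lra. }
assert (INR n * (Cmod a + Cmod b + Cmod a * Cmod b + R * Cmod c) <= INR n * (INR n * (R - 1)))%R
  by (apply Rmult_le_compat_l; lra).
assert (Cmod a * Cmod b <= INR n * (Cmod a * Cmod b))%R by nra.
nra.
Qed.

(* The recursion says exactly that the coefficients of [z F'' + c F'] have
   [a b] times those of [F] as successive differences. *)
Lemma hyp_ode (a b : C) (z : C) :
  (forall n : nat, a + b + 1 <> - INR n) -> (Cmod z < 1)%R ->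
  let u := hyp_coef a b (a + b + 1) in
  (1 - z) * (z * C_sum (C_sum_derive (C_sum_derive u)) z
             + (a + b + 1) * C_sum (C_sum_derive u) z) = a * b * C_sum u z.
Proof.
intros Hc Hz u.
set (c := a + b + 1) in *.
assert (U0 : unit_radius u) by (apply hyp_coef_unit_radius; exact Hc).
assert (U1 := unit_radius_derive _ U0).
assert (E0 := unit_radius_abs _ z U0 Hz).
assert (E1 := unit_radius_abs _ z U1 Hz).
assert (E2 := unit_radius_abs _ z (unit_radius_derive _ U1) Hz).
assert (Escal : forall (k : C) (w v : nat -> C), (forall n, v n = k * w n) ->
   ex_series (fun n => Cmod (w n)) -> ex_series (fun n => Cmod (v n))).
{ intros k w v H Hw; eapply ex_series_ext; [|apply (ex_series_scal_l (Cmod k)), Hw].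
  intros n; simpl; rewrite H, Cmod_mult; reflexivity. }
(* Multiplication by z as an index shift, the new zeroth term being 0. *)
assert (Hsh : forall (w v : nat -> C), ex_series (fun n => Cmod (w n)) ->
  v 0%nat = 0 -> (forall n, v (S n) = z * w n) ->
  ex_series (fun n => Cmod (v n)) /\ z * C_Series w = C_Series v).
{ intros w v Hw H0 HS.
  assert (Hv : ex_series (fun n => Cmod (v n))).
  { apply (ex_series_incr_1 (fun n => Cmod (v n))), (Escal z w); assumption. }
  split; [exact Hv|].
  rewrite (C_Series_incr_1 _ Hv), H0, Cplus_0_l, <- C_Series_scal by exact Hw.
  apply C_Series_ext; intros n; rewrite HS; reflexivity. }
destruct (Hsh _ (fun n => INR n * (C_sum_derive u n * z ^ n)) E2) as [Ee He].
{ simpl INR; ring. }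
{ intros n; unfold C_sum_derive; simpl Cpow; ring. }
unfold C_sum.
set (g := fun n => INR n * (C_sum_derive u n * z ^ n) + c * (C_sum_derive u n * z ^ n)).
assert (Eg : ex_series (fun n => Cmod (g n))).
{ apply (ex_series_le (K := R_AbsRing) (V := R_CompleteNormedModule) _
     (fun n => (Cmod (INR n * (C_sum_derive u n * z ^ n)) + Cmod (c * (C_sum_derive u n * z ^ n)))%R)).
  - intros n; match goal with |- norm ?x <= _ =>
      change (Rabs x <= Cmod (INR n * (C_sum_derive u n * z ^ n))
                        + Cmod (c * (C_sum_derive u n * z ^ n)))%R end.
    rewrite Rabs_right by (apply Rle_ge, Cmod_ge_0); apply Cmod_triangle.
  - apply (ex_series_plus (V := R_NormedModule)); [exact Ee|].
    apply (Escal c (fun n => C_sum_derive u n * z ^ n)); [reflexivity|exact E1]. }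
assert (Hg : z * C_Series (fun n => C_sum_derive (C_sum_derive u) n * z ^ n) +
   c * C_Series (fun n => C_sum_derive u n * z ^ n) = C_Series g).
{ rewrite He, <- C_Series_scal by exact E1.
  rewrite <- C_Series_plus; [reflexivity|exact Ee|].
  apply (Escal c (fun n => C_sum_derive u n * z ^ n)); [reflexivity|exact E1]. }
rewrite Hg.
destruct (Hsh _ (fun n => INR n * (INR n - 1 + c) * u n * z ^ n) Eg) as [Ek Hk].
{ simpl INR; ring. }
{ intros n; unfold g, C_sum_derive; rewrite S_INR, RtoC_plus; simpl Cpow; ring. }
replace ((1 - z) * C_Series g) with (C_Series g + (- (1)) * (z * C_Series g)) by ring.
rewrite Hk, <- !C_Series_scal by assumption.
rewrite <- C_Series_plus; [|exact Eg|].
2:{ eapply (Escal (- (1))); [reflexivity|exact Ek]. }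
apply C_Series_ext; intros n.
unfold g, C_sum_derive.
assert (Hr := hyp_coef_rec a b c n Hc); fold u in Hr.
(* After the recursion the claim is (a + n)(b + n) - n (n - 1 + c) = a b, which is where c = a + b +
   1 enters. *)
transitivity ((INR (S n) * (c + INR n) * u (S n)) * z ^ n
   - INR n * (INR n - 1 + c) * u n * z ^ n); [ring|].
rewrite Hr; unfold c; ring.
Qed.

Lemma C_Series_first (u : nat -> C) : (forall n, u (S n) = 0) -> C_Series u = u 0%nat.
Proof.
intros Hu.
assert (H : forall v : nat -> R, (forall n, v (S n) = 0%R) -> Series v = v 0%nat).
{ intros v Hv; rewrite Series_incr_1.
  - rewrite (Series_ext _ (fun n => 0 * 0)%R) by (intros n; rewrite Hv; ring).
    rewrite Series_scal_l; ring.
  - apply ex_series_incr_1; exists 0%R.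
    apply (is_series_ext (fun n => 0%R)); [intros n; rewrite Hv; reflexivity|].
    intros P HP; exists 0%nat; intros n _.
    rewrite sum_n_const, Rmult_0_r; apply locally_singleton, HP. }
unfold C_Series; rewrite !H; [|intros n; rewrite Hu; reflexivity|intros n; rewrite Hu; reflexivity].
destruct (u 0%nat); reflexivity.
Qed.

Lemma C_sum_0 (u : nat -> C) : C_sum u 0 = u 0%nat.
Proof.
unfold C_sum; rewrite C_Series_first; [simpl; ring|].
intros n; simpl; ring.
Qed.

Lemma pochhammer_0_l (n : nat) : pochhammer 0 (S n) = 0.
Proof.
induction n as [|n IH]; [simpl; ring|].
change (pochhammer 0 (S n) * (0 + INR (S n)) = 0); rewrite IH; ring.
Qed.

Lemma hyp2F1_degenerate (a b c z : C) : a * b = 0 -> hyp2F1 a b c z = 1.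
Proof.
intros Hab; unfold hyp2F1; rewrite C_Series_first.
- simpl; replace (1 * RtoC 1) with (RtoC 1) by ring; field; apply RtoC_neq_0; lra.
- intros n.
  assert (H : pochhammer a (S n) * pochhammer b (S n) = 0).
  { destruct (Ceq_dec a 0) as [->|Ha].
    - rewrite pochhammer_0_l; ring.
    - assert (Hb : b = 0).
      { transitivity (a * b / a); [field; exact Ha|rewrite Hab; unfold Cdiv; ring]. }
      rewrite Hb, pochhammer_0_l; ring. }
  rewrite H; unfold Cdiv; ring.
Qed.

(** * Complex derivatives with quadratic remainder *)

Lemma quad_deriv_eq (f : C -> C) (z l m : C) : quad_deriv f z l -> l = m -> quad_deriv f z m.
Proof. intros H <-; exact H. Qed.

Lemma quad_deriv_ext (f g : C -> C) (z l : C) :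
  (forall w, f w = g w) -> quad_deriv f z l -> quad_deriv g z l.
Proof.
intros H [K [d [Hd Hf]]]; exists K, d; split; [exact Hd|].
intros h Hh; rewrite <- !H; apply Hf, Hh.
Qed.

(** Normal form for the later estimates: nonnegative constants, and |h| < 1 so that |h|^2 is
    absorbed into |h|. *)
Lemma quad_deriv_lipschitz (f : C -> C) (z l : C) : quad_deriv f z l ->
  exists M K d : R, (0 < d)%R /\ (0 <= M)%R /\ (0 <= K)%R /\ forall h : C, (Cmod h < d)%R ->
    (Cmod (f (z + h) - f z - l * h)%C <= K * Cmod h ^ 2)%R /\
    (Cmod (f (z + h) - f z)%C <= M * Cmod h)%R /\ (Cmod h < 1)%R.
Proof.
intros [K [d [Hd Hf]]].
exists (Rabs K + Cmod l)%R, (Rabs K), (Rmin d 1).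
assert (HK := Rabs_pos K); assert (HK' := Rle_abs K); assert (Hl := Cmod_ge_0 l).
split; [apply Rmin_glb_lt; lra|].
split; [lra|]; split; [exact HK|].
intros h Hh.
assert (Hh1 : (Cmod h < d)%R) by (eapply Rlt_le_trans; [exact Hh|apply Rmin_l]).
assert (Hh2 : (Cmod h < 1)%R) by (eapply Rlt_le_trans; [exact Hh|apply Rmin_r]).
specialize (Hf h Hh1); assert (H0 := Cmod_ge_0 h).
assert (H1 : (Cmod (f (z + h) - f z - l * h)%C <= Rabs K * Cmod h ^ 2)%R).
{ eapply Rle_trans; [exact Hf|]; apply Rmult_le_compat_r; [apply pow2_ge_0|exact HK']. }
split; [exact H1|]; split; [|exact Hh2].
replace (f (z + h) - f z) with ((f (z + h) - f z - l * h) + l * h) by ring.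
eapply Rle_trans; [apply Cmod_triangle|]; rewrite Cmod_mult.
assert (Rabs K * Cmod h ^ 2 <= Rabs K * Cmod h)%R.
{ apply Rmult_le_compat_l; [exact HK|]; nra. }
lra.
Qed.

Lemma quad_deriv_const (k z : C) : quad_deriv (fun _ => k) z 0.
Proof.
exists 0%R, 1%R; split; [lra|]; intros h _.
replace (k - k - 0 * h) with (RtoC 0) by ring; rewrite Cmod_0; lra.
Qed.

Lemma quad_deriv_id (z : C) : quad_deriv (fun w => w) z 1.
Proof.
exists 0%R, 1%R; split; [lra|]; intros h _.
replace (z + h - z - 1 * h) with (RtoC 0) by ring; rewrite Cmod_0; lra.
Qed.

Lemma quad_deriv_plus (f g : C -> C) (z l m : C) :
  quad_deriv f z l -> quad_deriv g z m -> quad_deriv (fun w => f w + g w) z (l + m).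
Proof.
intros [K [d [Hd Hf]]] [K' [d' [Hd' Hg]]].
exists (K + K')%R, (Rmin d d'); split; [apply Rmin_glb_lt; assumption|].
intros h Hh.
specialize (Hf h (Rlt_le_trans _ _ _ Hh (Rmin_l _ _))).
specialize (Hg h (Rlt_le_trans _ _ _ Hh (Rmin_r _ _))).
replace (f (z + h) + g (z + h) - (f z + g z) - (l + m) * h) with
  ((f (z + h) - f z - l * h) + (g (z + h) - g z - m * h)) by ring.
eapply Rle_trans; [apply Cmod_triangle|]; lra.
Qed.

Lemma quad_deriv_mult (f g : C -> C) (z l m : C) :
  quad_deriv f z l -> quad_deriv g z m ->
  quad_deriv (fun w => f w * g w) z (l * g z + f z * m).
Proof.
intros Hf Hg.
destruct (quad_deriv_lipschitz _ _ _ Hf) as [M [K [d [Hd [HM [HK Hf']]]]]].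
destruct (quad_deriv_lipschitz _ _ _ Hg) as [M' [K' [d' [Hd' [HM' [HK' Hg']]]]]].
exists (K * (Cmod (g z) + M') + Cmod (f z) * K' + Cmod l * M')%R, (Rmin d d').
split; [apply Rmin_glb_lt; assumption|].
intros h Hh.
destruct (Hf' h (Rlt_le_trans _ _ _ Hh (Rmin_l _ _))) as [F1 [F2 H1]].
destruct (Hg' h (Rlt_le_trans _ _ _ Hh (Rmin_r _ _))) as [G1 [G2 _]].
assert (H0 := Cmod_ge_0 h).
replace (f (z + h) * g (z + h) - f z * g z - (l * g z + f z * m) * h) with
  (((f (z + h) - f z - l * h) * g (z + h) + f z * (g (z + h) - g z - m * h))
   + l * h * (g (z + h) - g z)) by ring.
eapply Rle_trans; [apply Cmod_triangle|].
eapply Rle_trans; [apply Rplus_le_compat_r, Cmod_triangle|].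
rewrite !Cmod_mult.
assert (G3 : (Cmod (g (z + h)%C) <= Cmod (g z) + M')%R).
{ replace (g (z + h)) with (g z + (g (z + h) - g z)) by ring.
  eapply Rle_trans; [apply Cmod_triangle|]; nra. }
assert (T1 : (Cmod (f (z + h) - f z - l * h)%C * Cmod (g (z + h)%C)
  <= (K * Cmod h ^ 2) * (Cmod (g z) + M'))%R)
  by (apply Rmult_le_compat; auto using Cmod_ge_0).
assert (T2 : (Cmod (f z) * Cmod (g (z + h) - g z - m * h)%C <= Cmod (f z) * (K' * Cmod h ^ 2))%R)
  by (apply Rmult_le_compat_l; auto using Cmod_ge_0).
assert (T3 : (Cmod l * Cmod h * Cmod (g (z + h) - g z)%C <= Cmod l * Cmod h * (M' * Cmod h))%R)
  by (apply Rmult_le_compat_l; [apply Rmult_le_pos; apply Cmod_ge_0|assumption]).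
nra.
Qed.

Lemma quad_deriv_inv (g : C -> C) (z m : C) :
  quad_deriv g z m -> g z <> 0 -> quad_deriv (fun w => / g w) z (- m / (g z * g z)).
Proof.
intros Hg Hgz.
destruct (quad_deriv_lipschitz _ _ _ Hg) as [M [K [d [Hd [HM [HK Hg']]]]]].
assert (Hp : (0 < Cmod (g z))%R) by (apply Cmod_gt_0; exact Hgz).
set (p := Cmod (g z)) in *.
(* Within p/(2 (M + 1)) the function g varies by at most p/2, so |g (z + h)| >= p/2; this gives the
   factor 2/p^3. *)
exists ((p * K + Cmod m * M) * (2 / (p * p * p)))%R, (Rmin d (p / (2 * (M + 1))))%R.
assert (Hq : (0 < p / (2 * (M + 1)))%R) by (apply Rdiv_lt_0_compat; lra).
split; [apply Rmin_glb_lt; assumption|].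
intros h Hh.
destruct (Hg' h (Rlt_le_trans _ _ _ Hh (Rmin_l _ _))) as [G1 [G2 _]].
assert (Hh2 := Rlt_le_trans _ _ _ Hh (Rmin_r _ _)).
assert (H0 := Cmod_ge_0 h).
assert (G3 : (p / 2 <= Cmod (g (z + h)%C))%R).
{ assert (Ht := Cmod_triangle (g (z + h)) (- (g (z + h) - g z))).
  replace (g (z + h) + - (g (z + h) - g z)) with (g z) in Ht by ring.
  rewrite Cmod_opp in Ht; fold p in Ht.
  assert (M * Cmod h <= p / 2)%R.
  { apply Rle_trans with ((M + 1) * (p / (2 * (M + 1))))%R.
    - apply Rmult_le_compat; lra.
    - right; field; lra. }
  lra. }
assert (Hgh : g (z + h) <> 0) by (apply Cmod_gt_0; lra).
replace (/ g (z + h) - / g z - - m / (g z * g z) * h) with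
  ((- g z * (g (z + h) - g z - m * h) + m * h * (g (z + h) - g z)) *
   / (g z * g z * g (z + h))) by (field; split; assumption).
rewrite Cmod_mult, Cmod_inv by (repeat apply Cmult_neq_0; assumption).
rewrite !Cmod_mult; fold p.
assert (T1 : (Cmod (- g z * (g (z + h) - g z - m * h) + m * h * (g (z + h) - g z))%C
   <= (p * K + Cmod m * M) * Cmod h ^ 2)%R).
{ eapply Rle_trans; [apply Cmod_triangle|].
  rewrite !Cmod_mult, Cmod_opp; fold p.
  assert (p * Cmod (g (z + h) - g z - m * h)%C <= p * (K * Cmod h ^ 2))%R
    by (apply Rmult_le_compat_l; lra).
  assert (Cmod m * Cmod h * Cmod (g (z + h) - g z)%C <= Cmod m * Cmod h * (M * Cmod h))%R
    by (apply Rmult_le_compat_l; [apply Rmult_le_pos; apply Cmod_ge_0|assumption]).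
  nra. }
assert (Hpp : (0 < p * p)%R) by (apply Rmult_lt_0_compat; assumption).
assert (T2 : (/ (p * p * Cmod (g (z + h)%C)) <= 2 / (p * p * p))%R).
{ replace (2 / (p * p * p))%R with (/ (p * p * (p / 2)))%R by (field; lra).
  apply Rinv_le_contravar; [apply Rmult_lt_0_compat; lra|].
  apply Rmult_le_compat_l; lra. }
replace ((p * K + Cmod m * M) * (2 / (p * p * p)) * Cmod h ^ 2)%R with
  ((p * K + Cmod m * M) * Cmod h ^ 2 * (2 / (p * p * p)))%R by ring.
apply Rmult_le_compat; [apply Cmod_ge_0| |exact T1|exact T2].
left; apply Rinv_0_lt_compat, Rmult_lt_0_compat; lra.
Qed.

Lemma quad_deriv_cont (f : C -> C) (z l : C) : quad_deriv f z l ->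
  forall e : R, (0 < e)%R -> exists d : R, (0 < d)%R /\
    forall w : C, (Cmod (w - z) < d)%R -> (Cmod (f w - f z) < e)%R.
Proof.
intros Hf e He.
destruct (quad_deriv_lipschitz _ _ _ Hf) as [M [K [d [Hd [HM [HK Hf']]]]]].
exists (Rmin d (e / (M + 1))); split.
{ apply Rmin_glb_lt; [exact Hd|apply Rdiv_lt_0_compat; lra]. }
intros w Hw.
destruct (Hf' (w - z) (Rlt_le_trans _ _ _ Hw (Rmin_l _ _))) as [_ [G _]].
assert (Hw2 := Rlt_le_trans _ _ _ Hw (Rmin_r _ _)).
replace (z + (w - z)) with w in G by ring.
assert (H0 := Cmod_ge_0 (w - z)).
assert ((M + 1) * Cmod (w - z) < (M + 1) * (e / (M + 1)))%R
  by (apply Rmult_lt_compat_l; lra).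
replace ((M + 1) * (e / (M + 1)))%R with e in * by (field; lra).
lra.
Qed.

Lemma quad_deriv_is_derive (f : C -> C) (z l : C) : quad_deriv f z l ->
  @is_derive C_AbsRing C_NormedModule f z l.
Proof.
intros [K [d [Hd Hf]]]; split.
- apply (is_linear_scal_l (K := C_AbsRing) (V := C_NormedModule)).
- intros x Hx.
  assert (E := is_filter_lim_locally_unique (K := C_AbsRing) (V := AbsRing_NormedModule C_AbsRing) z x Hx).
  rewrite <- E; clear x Hx E.
  intros eps.
  assert (HK : (0 < Rabs K + 1)%R) by (generalize (Rabs_pos K); lra).
  assert (He : (0 < Rmin d (eps / (Rabs K + 1)))%R)
    by (apply Rmin_glb_lt; [exact Hd|apply Rdiv_lt_0_compat; [apply eps|exact HK]]).
  apply (locally_le_locally_norm (K := C_AbsRing) (V := AbsRing_NormedModule C_AbsRing)).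
  exists (mkposreal _ He).
  enough (Hb : forall y : C, (Cmod (y - z) < Rmin d (eps / (Rabs K + 1)))%R ->
    (Cmod (f y - f z - (y - z) * l)%C <= eps * Cmod (y - z))%R) by exact Hb.
  intros y Hy.
  assert (H1 := Hf _ (Rlt_le_trans _ _ _ Hy (Rmin_l _ _))).
  assert (H2 := Rlt_le_trans _ _ _ Hy (Rmin_r _ _)).
  replace (z + (y - z)) with y in H1 by ring.
  rewrite (Cmult_comm l) in H1.
  eapply Rle_trans; [exact H1|].
  assert (H0 := Cmod_ge_0 (y - z)).
  replace (K * Cmod (y - z) ^ 2)%R with (K * Cmod (y - z) * Cmod (y - z))%R by ring.
  apply Rmult_le_compat_r; [exact H0|].
  assert ((Rabs K + 1) * Cmod (y - z) < (Rabs K + 1) * (eps / (Rabs K + 1)))%R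
    by (apply Rmult_lt_compat_l; lra).
  replace ((Rabs K + 1) * (eps / (Rabs K + 1)))%R with (pos eps) in * by (field; lra).
  generalize (Rle_abs K); nra.
Qed.

(** Componentwise, so that real one-variable calculus applies to restrictions of complex functions
    to lines. *)
Definition curve_deriv (g : R -> C) (t : R) (l : C) : Prop :=
  is_derive (fun s => Re (g s)) t (Re l) /\ is_derive (fun s => Im (g s)) t (Im l).

Lemma is_derive_quad (g : R -> R) (t l K d : R) : (0 < d)%R ->
  (forall s, (Rabs s < d)%R -> (Rabs (g (t + s) - g t - l * s) <= K * s ^ 2)%R) ->
  is_derive g t l.
Proof.
intros Hd H; apply is_derive_Reals; intros e He.
assert (HK : (0 < Rabs K + 1)%R) by (generalize (Rabs_pos K); lra).
assert (Hm : (0 < Rmin d (e / (Rabs K + 1)))%R)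
  by (apply Rmin_glb_lt; [exact Hd|apply Rdiv_lt_0_compat; assumption]).
exists (mkposreal _ Hm); intros s Hs Hsd; simpl in Hsd.
assert (H1 := H s (Rlt_le_trans _ _ _ Hsd (Rmin_l _ _))).
assert (H2 := Rlt_le_trans _ _ _ Hsd (Rmin_r _ _)).
assert (Hp : (0 < Rabs s)%R) by (apply Rabs_pos_lt; exact Hs).
replace ((g (t + s) - g t) / s - l)%R with ((g (t + s) - g t - l * s) / s)%R by (field; exact Hs).
unfold Rdiv; rewrite Rabs_mult, Rabs_inv.
apply Rmult_lt_reg_r with (Rabs s); [exact Hp|].
rewrite Rmult_assoc, Rinv_l, Rmult_1_r by lra.
eapply Rle_lt_trans; [exact H1|].
rewrite <- (Rsqr_pow2 s), Rsqr_abs; unfold Rsqr.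
rewrite <- Rmult_assoc; apply Rmult_lt_compat_r; [exact Hp|].
assert ((Rabs K + 1) * Rabs s < (Rabs K + 1) * (e / (Rabs K + 1)))%R
    by (apply Rmult_lt_compat_l; lra).
replace ((Rabs K + 1) * (e / (Rabs K + 1)))%R with e in * by (field; lra).
generalize (Rle_abs K); nra.
Qed.

Lemma quad_deriv_line (f : C -> C) (z u l : C) (t : R) : quad_deriv f (z + t * u) l ->
  curve_deriv (fun s => f (z + s * u)) t (u * l).
Proof.
intros [K [d [Hd H]]].
assert (Hu := Cmod_ge_0 u).
assert (Hm : (0 < d / (Cmod u + 1))%R) by (apply Rdiv_lt_0_compat; lra).
assert (Hb : forall s, (Rabs s < d / (Cmod u + 1))%R ->
  (Cmod (f (z + (t + s)%R * u) - f (z + t * u) - (u * l) * s)%C <= (K * Cmod u ^ 2) * s ^ 2)%R).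
{ intros s Hs.
  assert (Hsu : (Cmod (s * u) < d)%R).
  { rewrite Cmod_mult, Cmod_R.
    assert (Rabs s * (Cmod u + 1) < d / (Cmod u + 1) * (Cmod u + 1))%R
      by (apply Rmult_lt_compat_r; lra).
    replace (d / (Cmod u + 1) * (Cmod u + 1))%R with d in * by (field; lra).
    generalize (Rabs_pos s); nra. }
  specialize (H _ Hsu).
  replace (z + t * u + s * u) with (z + (t + s)%R * u) in H by (rewrite RtoC_plus; ring).
  replace (u * l * s) with (l * (s * u)) by ring.
  eapply Rle_trans; [exact H|].
  rewrite Cmod_mult, Cmod_R, Rpow_mult_distr, pow2_abs; right; ring. }
split.
- apply is_derive_quad with (1 := Hm) (K := (K * Cmod u ^ 2)%R); intros s Hs.
  eapply Rle_trans; [|apply (Hb s Hs)].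
  eapply Rle_trans; [|apply re_le_Cmod].
  right; f_equal; unfold Re; simpl; ring.
- apply is_derive_quad with (1 := Hm) (K := (K * Cmod u ^ 2)%R); intros s Hs.
  eapply Rle_trans; [|apply (Hb s Hs)].
  eapply Rle_trans; [|apply im_le_Cmod].
  right; f_equal; unfold Im; simpl; ring.
Qed.

Lemma curve_deriv_dot (f g : R -> C) (t : R) (l m : C) :
  curve_deriv f t l -> curve_deriv g t m ->
  is_derive (fun s => Re (Cconj (f s) * g s)) t (Re (Cconj l * g t + Cconj (f t) * m)).
Proof.
intros [F1 F2] [G1 G2].
apply (is_derive_ext (fun s => (Re (f s) * Re (g s) + Im (f s) * Im (g s))%R)).
{ intros s; destruct (f s), (g s); simpl; ring. }
evar_last.
- apply (is_derive_plus (V := R_NormedModule)).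
  + apply (is_derive_mult (fun s => Re (f s)) (fun s => Re (g s)) t _ _ F1 G1 Rmult_comm).
  + apply (is_derive_mult (fun s => Im (f s)) (fun s => Im (g s)) t _ _ F2 G2 Rmult_comm).
- destruct (f t), (g t), l, m; unfold plus, mult; simpl. ring.
Qed.

(** * Compactness and the maximum principle *)

(** Heine-Borel on a square containing K: a parameter valid near some centre may be lowered to the
    common d. The local condition is asked of every z, also outside K, because the compactness
    theorem covers the whole square. *)
Lemma compact_uniform (K : C -> Prop) (Q : R -> C -> Prop) (B : R) :
  (forall z, K z -> (Cmod z <= B)%R) ->
  (forall z, exists d : R, (0 < d)%R /\
     forall w, (Cmod (w - z) < d)%R -> K w -> Q d w) ->
  (forall d d' w, (0 < d' <= d)%R -> Q d w -> Q d' w) ->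
  exists d : R, (0 < d)%R /\ forall w, K w -> Q d w.
Proof.
intros HB Hloc Hmon.
set (D := fun z => constructive_indefinite_description _ (Hloc z)).
(* Halved because compactness controls each coordinate separately, and the modulus is at most the
   sum of the two deviations. *)
assert (Dpos : forall z, (0 < proj1_sig (D z) / 2)%R)
  by (intros z; destruct (proj2_sig (D z)); lra).
destruct (compactness_value_2d (- B) B (- B) B
  (fun x y => mkposreal _ (Dpos (x, y)))) as [d Hd].
exists d; split; [apply cond_pos|]; intros [x y] Hw.
assert (HwB := HB _ Hw).
assert (Hx := Rle_trans _ _ _ (re_le_Cmod (x, y)) HwB); simpl in Hx.
assert (Hy := Rle_trans _ _ _ (im_le_Cmod (x, y)) HwB); simpl in Hy.
apply Rabs_le_between in Hx; apply Rabs_le_between in Hy.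
apply NNPP; intros Hn; apply (Hd x y Hx Hy); intros [u [v [_ [_ [Hu [Hv Hle]]]]]].
apply Hn; simpl in Hu, Hv, Hle.
destruct (proj2_sig (D (u, v))) as [H0 H1].
apply (Hmon (proj1_sig (D (u, v)))); [split; [apply cond_pos|lra]|].
apply H1; [|exact Hw].
eapply Rle_lt_trans; [apply Cmod_le_Re_Im|].
unfold Re, Im; simpl.
unfold Rminus in Hu, Hv; lra.
Qed.

Definition metric_closed (K : C -> Prop) : Prop :=
  forall z, ~ K z -> exists d : R, (0 < d)%R /\ forall w, (Cmod (w - z) < d)%R -> ~ K w.

(** The last hypothesis is upper semicontinuity, enough for a maximum. Compactness is used twice:
    for an upper bound and, if the supremum M were not attained, for a uniform gap below M, which is
    absurd. *)
Lemma compact_max (K : C -> Prop) (g : C -> R) (B : R) :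
  (exists z, K z) -> (forall z, K z -> (Cmod z <= B)%R) -> metric_closed K ->
  (forall z, K z -> forall e : R, (0 < e)%R -> exists d : R, (0 < d)%R /\
     forall w, (Cmod (w - z) < d)%R -> (g w < g z + e)%R) ->
  exists z0, K z0 /\ forall z, K z -> (g z <= g z0)%R.
Proof.
intros [z1 Hz1] HB Hcl Husc.
(* The bound is written [/ d] so that it weakens as d shrinks. *)
destruct (compact_uniform K (fun d w => (g w <= / d)%R) B HB) as [d0 [Hd0 Hbd]].
{ intros z; destruct (classic (K z)) as [Hz|Hz].
  - destruct (Husc z Hz 1%R Rlt_0_1) as [d [Hd H]].
    assert (Hg := Rabs_pos (g z)).
    assert (Hp : (0 < / (Rabs (g z) + 1))%R) by (apply Rinv_0_lt_compat; lra).
    exists (Rmin d (/ (Rabs (g z) + 1))); split; [apply Rmin_glb_lt; assumption|].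
    intros w Hw _.
    assert (H1 := H w (Rlt_le_trans _ _ _ Hw (Rmin_l _ _))).
    apply Rle_trans with (/ / (Rabs (g z) + 1))%R.
    + rewrite Rinv_inv; generalize (Rle_abs (g z)); lra.
    + apply Rinv_le_contravar; [apply Rmin_glb_lt; assumption|apply Rmin_r].
  - destruct (Hcl z Hz) as [d [Hd H]]; exists d; split; [exact Hd|].
    intros w Hw Kw; destruct (H w Hw Kw). }
{ intros d d' w Hdd H; eapply Rle_trans; [exact H|]; apply Rinv_le_contravar; lra. }
destruct (completeness (fun x => exists z, K z /\ x = g z)) as [M [HM1 HM2]].
{ exists (/ d0)%R; intros x [z [Hz ->]]; auto. }
{ exists (g z1), z1; auto. }
apply NNPP; intros Hno.
assert (HltM : forall z, K z -> (g z < M)%R).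
{ intros z Hz; destruct (Rle_lt_or_eq_dec (g z) M) as [H|H].
  - apply HM1; exists z; auto.
  - exact H.
  - exfalso; apply Hno; exists z; split; [exact Hz|].
    intros w Hw; rewrite H; apply HM1; exists w; auto. }
destruct (compact_uniform K (fun d w => (g w <= M - d)%R) B HB) as [d [Hd HMd]].
{ intros z; destruct (classic (K z)) as [Hz|Hz].
  - assert (HzM := HltM z Hz).
    destruct (Husc z Hz ((M - g z) / 2)%R) as [d [Hd H]]; [lra|].
    exists (Rmin d ((M - g z) / 2)); split; [apply Rmin_glb_lt; lra|].
    intros w Hw _.
    assert (H1 := H w (Rlt_le_trans _ _ _ Hw (Rmin_l _ _))).
    assert (H2 := Rmin_r d ((M - g z) / 2)); lra.
  - destruct (Hcl z Hz) as [d [Hd H]]; exists d; split; [exact Hd|].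
    intros w Hw Kw; destruct (H w Hw Kw). }
{ intros e e' w Hee H; lra. }
assert (M <= M - d)%R.
{ apply HM2; intros x [z [Hz ->]]; auto. }
lra.
Qed.

(** Fermat's theorem makes [h1] vanish at 0; a positive [h2] then makes [h1] positive just to the
    right, and the mean value theorem lifts h above its value at 0. *)
Lemma second_deriv_test (h h1 : R -> R) (h2 d : R) : (0 < d)%R ->
  (forall t, (Rabs t < d)%R -> is_derive h t (h1 t)) -> is_derive h1 0%R h2 -> (0 < h2)%R ->
  (forall t, (Rabs t < d)%R -> (h t <= h 0%R)%R) -> False.
Proof.
intros Hd Hh Hh1 Hpos Hmax.
assert (H0 : h1 0%R = 0%R).
{ assert (D0 : derivable_pt_lim h 0 (h1 0%R))
    by (apply is_derive_Reals, Hh; rewrite Rabs_R0; exact Hd).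
  rewrite <- (derive_pt_eq_0 h 0 (h1 0%R) (exist _ _ D0) D0).
  apply (deriv_maximum h (- d) d); [lra|lra|].
  intros x Hx1 Hx2; apply Hmax, Rabs_def1; lra. }
apply is_derive_Reals in Hh1.
destruct (Hh1 (h2 / 2)%R) as [e He]; [lra|].
set (x := (Rmin d e / 2)%R).
assert (Hx : (0 < x)%R) by (unfold x; generalize (Rmin_glb_lt _ _ _ Hd (cond_pos e)); lra).
assert (Hxd : (x < d)%R) by (unfold x in *; generalize (Rmin_l d e); lra).
assert (Hxe : (x < e)%R) by (unfold x in *; generalize (Rmin_r d e); lra).
destruct (MVT_cor2 h h1 0 x Hx) as [c [Hc1 Hc2]].
{ intros c Hc; apply is_derive_Reals, Hh, Rabs_def1; lra. }
assert (Hmx := Hmax x ltac:(apply Rabs_def1; lra)).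
assert (Hce := He c ltac:(lra) ltac:(apply Rabs_def1; lra)).
rewrite Rplus_0_l, H0, Rminus_0_r in Hce.
apply Rabs_def2 in Hce; destruct Hce as [_ Hce].
assert (Hq : (0 < h1 c / c)%R) by lra.
assert (Hh1c : (0 < h1 c)%R).
{ replace (h1 c) with (h1 c / c * c)%R by (field; lra); apply Rmult_lt_0_compat; lra. }
assert (0 < h1 c * (x - 0))%R by (apply Rmult_lt_0_compat; lra).
lra.
Qed.

Lemma Cmod2_dot (z : C) : (Cmod z ^ 2)%R = Re (Cconj z * z).
Proof. rewrite Cmod2_alt; destruct z; simpl; ring. Qed.

Lemma Cmod_continuous_sqr (f : C -> C) (z : C) :
  (forall e : R, (0 < e)%R -> exists d : R, (0 < d)%R /\
    forall w : C, (Cmod (w - z) < d)%R -> (Cmod (f w - f z) < e)%R) ->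
  forall e : R, (0 < e)%R -> exists d : R, (0 < d)%R /\
    forall w : C, (Cmod (w - z) < d)%R -> (Rabs (Cmod (f w) ^ 2 - Cmod (f z) ^ 2) < e)%R.
Proof.
intros H e He.
assert (H0 := Cmod_ge_0 (f z)).
assert (Hp : (0 < e / (2 * Cmod (f z) + 2))%R) by (apply Rdiv_lt_0_compat; lra).
destruct (H (Rmin 1 (e / (2 * Cmod (f z) + 2)))) as [d [Hd Hw]].
{ apply Rmin_glb_lt; lra. }
exists d; split; [exact Hd|]; intros w Hwz; specialize (Hw w Hwz).
assert (A1 := Rlt_le_trans _ _ _ Hw (Rmin_l _ _)).
assert (A2 := Rlt_le_trans _ _ _ Hw (Rmin_r _ _)).
assert (H1 := Cmod_ge_0 (f w)).
assert (B1 : (Cmod (f w) <= Cmod (f z) + Cmod (f w - f z)%C)%R).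
{ replace (f w) with (f z + (f w - f z)) at 1 by ring; apply Cmod_triangle. }
assert (B2 : (Cmod (f z) <= Cmod (f w) + Cmod (f w - f z)%C)%R).
{ replace (f z) with (f w + - (f w - f z)) at 1 by ring.
  rewrite <- (Cmod_opp (f w - f z)); apply Cmod_triangle. }
set (a := Cmod (f w)) in *; set (b := Cmod (f z)) in *; set (x := Cmod (f w - f z)%C) in *.
assert (Hx : (x * (2 * b + 2) < e)%R).
{ apply Rlt_le_trans with (e / (2 * b + 2) * (2 * b + 2))%R.
  - apply Rmult_lt_compat_r; lra.
  - right; field; lra. }
assert (Hx0 : (0 <= x)%R) by (apply Cmod_ge_0).
apply Rabs_def1; nra.
Qed.

(* [|psi|^2 + e |z|^2] has Laplacian [4 |psi'|^2 + 4 e > 0], hence no interior maximum. *)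
Lemma maximum_principle (psi psi1 : C -> C) (rho r B : R) :
  (0 < r < rho)%R ->
  (forall z, (Cmod z < rho)%R -> quad_deriv psi z (psi1 z)) ->
  (forall z, (Cmod z < rho)%R -> exists l, quad_deriv psi1 z l) ->
  (forall z, Cmod z = r -> (Cmod (psi z) <= B)%R) ->
  forall z, (Cmod z <= r)%R -> (Cmod (psi z) <= B)%R.
Proof.
intros Hr H1 H2 Hbd z Hz.
apply Rnot_lt_le; intros HBz.
assert (HB : (0 <= B)%R).
{ eapply Rle_trans; [apply (Cmod_ge_0 (psi r))|].
  apply Hbd; rewrite Cmod_R; apply Rabs_right; lra. }
(* On the circle of radius r this e spends only half of the supposed excess |psi z|^2 - B^2, so the
   maximum of [g] cannot lie there. *)
set (e := ((Cmod (psi z) ^ 2 - B ^ 2) / (2 * r ^ 2))%R).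
assert (Hr2 : (0 < r ^ 2)%R) by (apply pow_lt; lra).
assert (Hdiff : (0 < Cmod (psi z) ^ 2 - B ^ 2)%R) by nra.
assert (He : (0 < e)%R) by (unfold e; apply Rdiv_lt_0_compat; lra).
assert (Her : (B ^ 2 + e * r ^ 2 < Cmod (psi z) ^ 2)%R).
{ replace (e * r ^ 2)%R with ((Cmod (psi z) ^ 2 - B ^ 2) / 2)%R by (unfold e; field; lra). lra. }
set (g := fun w => (Cmod (psi w) ^ 2 + e * Cmod w ^ 2)%R).
destruct (compact_max (fun w => (Cmod w <= r)%R) g r) as [z0 [Hz0 Hmax]].
- exists z; exact Hz.
- auto.
- intros w Hw; exists (Cmod w - r)%R; split; [lra|].
  intros v Hv Hvr.
  assert (Ht := Cmod_triangle v (- (v - w))).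
  replace (v + - (v - w)) with w in Ht by ring; rewrite Cmod_opp in Ht; lra.
- intros w Hw e' He'.
  assert (Hwr : (Cmod w < rho)%R) by lra.
  destruct (Cmod_continuous_sqr psi w (quad_deriv_cont _ _ _ (H1 w Hwr)) (e' / 2)) as [d [Hd Cd]]; [lra|].
  destruct (Cmod_continuous_sqr (fun v => v) w (quad_deriv_cont _ _ _ (quad_deriv_id w)) (e' / (2 * e)))
    as [d' [Hd' Cd']].
  { apply Rdiv_lt_0_compat; lra. }
  exists (Rmin d d'); split; [apply Rmin_glb_lt; assumption|].
  intros v Hv; unfold g.
  assert (A1 := Cd v (Rlt_le_trans _ _ _ Hv (Rmin_l _ _))).
  assert (A2 := Cd' v (Rlt_le_trans _ _ _ Hv (Rmin_r _ _))).
  apply Rabs_def2 in A1; apply Rabs_def2 in A2.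
  destruct A2 as [A2 _]; apply (Rmult_lt_compat_l e) in A2; [|exact He].
  replace (e * (e' / (2 * e)))%R with (e' / 2)%R in A2 by (field; lra).
  lra.
- assert (Hz0z := Hmax z Hz).
  assert (Hgz : (Cmod (psi z) ^ 2 <= g z)%R).
  { unfold g; generalize (pow2_ge_0 (Cmod z)); nra. }
  assert (Hz0r : (Cmod z0 < r)%R).
  { destruct Hz0 as [Hlt|Heq]; [exact Hlt|exfalso].
    assert (Hb := Hbd z0 Heq); unfold g in Hz0z at 2; rewrite Heq in Hz0z.
    assert (H0 := Cmod_ge_0 (psi z0)); nra. }
  assert (Hline : forall (u : C) (t : R), Cmod u = 1%R -> (Rabs t < r - Cmod z0)%R ->
    (Cmod (z0 + t * u)%C < r)%R).
  { intros u t Hu Ht; eapply Rle_lt_trans; [apply Cmod_triangle|].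
    rewrite Cmod_mult, Cmod_R, Hu; lra. }
  destruct (H2 z0 (Rlt_trans _ _ _ Hz0r (proj2 Hr))) as [m Hm].
  (* The left side is half the second derivative of [g] at z0 in the direction u. *)
  assert (Key : forall u : C, Cmod u = 1%R ->
    (Re (Cconj (u * psi1 z0) * (u * psi1 z0) + Cconj (psi z0) * (u * (u * m))) + e <= 0)%R).
  { intros u Hu; apply Rnot_lt_le; intros Hpos.
    assert (Hd0 : (0 < r - Cmod z0)%R) by lra.
    set (p := fun t : R => z0 + t * u).
    refine (second_deriv_test
      (fun t => (Re (Cconj (psi (p t)) * psi (p t)) + e * Re (Cconj (p t) * p t))%R)
      (fun t => (2 * Re (Cconj (psi (p t)) * (u * psi1 (p t))) + e * (2 * Re (Cconj (p t) * u)))%R)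
      (2 * Re (Cconj (u * psi1 (p 0%R)) * (u * psi1 (p 0%R))
               + Cconj (psi (p 0%R)) * (u * (u * m)))
        + e * (2 * 1))%R (r - Cmod z0) Hd0 _ _ _ _); unfold p; clear p.
    - intros t Ht; assert (Hl := Hline u t Hu Ht).
      assert (C1 := quad_deriv_line psi z0 u _ t (H1 _ (Rlt_trans _ _ _ Hl (proj2 Hr)))).
      assert (C2 := quad_deriv_line (fun w => w) z0 u _ t (quad_deriv_id _)).
      evar_last.
      + apply (is_derive_plus (V := R_NormedModule)).
        * apply (curve_deriv_dot _ _ _ _ _ C1 C1).
        * apply is_derive_scal, (curve_deriv_dot _ _ _ _ _ C2 C2).
      + destruct (psi (z0 + t * u)), (psi1 (z0 + t * u)), u, z0.
        unfold plus, Re; simpl; ring.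
    - assert (Ht : (Rabs 0 < r - Cmod z0)%R) by (rewrite Rabs_R0; lra).
      assert (Hl := Hline u 0%R Hu Ht).
      assert (C1 := quad_deriv_line psi z0 u _ 0 (H1 _ (Rlt_trans _ _ _ Hl (proj2 Hr)))).
      assert (C2 := quad_deriv_line (fun w => w) z0 u _ 0 (quad_deriv_id _)).
      assert (Hm0 : quad_deriv psi1 (z0 + 0%R * u) m)
        by (replace (z0 + 0%R * u) with z0 by ring; exact Hm).
      assert (C3 := quad_deriv_line (fun w => u * psi1 w) z0 u _ 0
        (quad_deriv_mult _ _ _ _ _ (quad_deriv_const u _) Hm0)).
      assert (C4 := quad_deriv_line (fun w => u) z0 u _ 0 (quad_deriv_const u _)).
      evar_last.
      + apply (is_derive_plus (V := R_NormedModule)).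
        * apply is_derive_scal, (curve_deriv_dot _ _ _ _ _ C1 C3).
        * apply is_derive_scal, is_derive_scal, (curve_deriv_dot _ _ _ _ _ C2 C4).
      + assert (Hu2 : Re (Cconj u * u) = 1%R) by (rewrite <- Cmod2_dot, Hu; ring).
        replace (e * (2 * 1))%R with (e * (2 * Re (Cconj u * u)))%R by (rewrite Hu2; reflexivity).
        destruct (psi (z0 + 0%R * u)), (psi1 (z0 + 0%R * u)), m, u, z0.
        unfold plus, Re; simpl; ring.
    - replace (z0 + 0%R * u) with z0 by ring; lra.
    - intros t Ht; assert (Hl := Hline u t Hu Ht).
      rewrite <- !Cmod2_dot.
      replace (z0 + 0%R * u) with z0 by ring.
      apply Hmax; lra. }
  (* For the directions 1 and i the terms with u^2 m cancel in the sum, leaving |psi1 z0|^2 + e <=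
     0. *)
  assert (K1 := Key 1 Cmod_1).
  assert (K2 := Key Ci Cmod_Ci).
  destruct (psi z0), (psi1 z0), m; unfold Re in K1, K2; simpl in K1, K2; nra.
Qed.

(** * Jack's lemma and the boundary identity *)

Lemma derive_at_right_max (h : R -> R) (l : R) :
  is_derive h 0%R l ->
  (exists d : R, (0 < d)%R /\ forall t, (0 < t < d)%R -> (h t <= h 0%R)%R) -> (l <= 0)%R.
Proof.
intros Hh [d [Hd H]]; apply Rnot_lt_le; intros Hl.
apply is_derive_Reals in Hh.
destruct (Hh l Hl) as [e He].
set (x := (Rmin d e / 2)%R).
assert (Hx : (0 < x)%R) by (unfold x; generalize (Rmin_glb_lt _ _ _ Hd (cond_pos e)); lra).
assert (Hxd : (x < d)%R) by (unfold x in *; generalize (Rmin_l d e); lra).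
assert (Hxe : (x < e)%R) by (unfold x in *; generalize (Rmin_r d e); lra).
assert (H1 := H x (conj Hx Hxd)).
assert (H2 := He x ltac:(lra) ltac:(apply Rabs_def1; lra)).
rewrite Rplus_0_l in H2; apply Rabs_def2 in H2; destruct H2 as [_ H2].
assert (H3 : (0 < (h x - h 0) / x)%R) by lra.
assert (0 < h x - h 0)%R; [|lra].
replace (h x - h 0)%R with ((h x - h 0) / x * x)%R by (field; lra).
apply Rmult_lt_0_compat; assumption.
Qed.

(** At a boundary maximum of [|psi|] the inward derivatives of [|psi|^2] are
   nonpositive in all directions [z0 (-1 + i y)]. *)
Lemma boundary_maximum (psi : C -> C) (z0 l : C) :
  quad_deriv psi z0 l -> z0 <> 0 -> psi z0 <> 0 ->
  (forall z, (Cmod z < Cmod z0)%R -> (Cmod (psi z) <= Cmod (psi z0))%R) ->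
  exists k : R, (0 <= k)%R /\ z0 * l = k * psi z0.
Proof.
intros Hpsi Hz0 Hp Hmax.
set (kap := z0 * l / psi z0).
assert (Hl : l = kap * psi z0 / z0) by (unfold kap; field; auto).
(* This is Re ((-1 + i y) kap), half the derivative of log |psi|^2 in the direction z0 (-1 + i
   y). *)
assert (Key : forall y : R, (- Re kap - y * Im kap <= 0)%R).
{ intros y.
  set (u := z0 * (-1, y)%R).
  assert (Hq : quad_deriv psi (z0 + 0%R * u) l)
    by (replace (z0 + 0%R * u) with z0 by ring; exact Hpsi).
  assert (C1 := quad_deriv_line psi z0 u _ 0 Hq).
  assert (D := curve_deriv_dot _ _ _ _ _ C1 C1).
  apply derive_at_right_max in D.
  - replace (z0 + 0%R * u) with z0 in D by ring.
    assert (Hul : u * l = (-1, y)%R * kap * psi z0) by (unfold u; rewrite Hl; field; auto).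
    rewrite Hul in D.
    assert (Hm : (0 < Cmod (psi z0) ^ 2)%R) by (apply pow_lt, Cmod_gt_0, Hp).
    rewrite Cmod2_alt in Hm.
    clear - D Hm; set (p := psi z0) in *; clearbody p kap.
    destruct p as [p1 p2], kap as [k1 k2]; unfold Re, Im in *; simpl in *.
    nra.
  (* For such t the squared modulus of 1 - t + i t y, namely 1 - 2 t + t^2 (1 + y^2), stays below
     1. *)
  - exists (/ (1 + y ^ 2))%R.
    assert (Hy := pow2_ge_0 y).
    split; [apply Rinv_0_lt_compat; lra|]; intros t Ht.
    rewrite <- !Cmod2_dot.
    replace (z0 + 0%R * u) with z0 by ring.
    apply pow_incr; split; [apply Cmod_ge_0|].
    apply Hmax.
    replace (z0 + t * u) with (z0 * (1 - t, t * y)%R)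
      by (unfold u; destruct z0; apply injective_projections; simpl; ring).
    rewrite Cmod_mult; rewrite <- (Rmult_1_r (Cmod z0)) at 2.
    apply Rmult_lt_compat_l; [apply Cmod_gt_0; exact Hz0|].
    unfold Cmod; simpl fst; simpl snd.
    eapply Rlt_le_trans; [|right; apply sqrt_1].
    apply sqrt_lt_1_alt; split; [generalize (pow2_ge_0 (1 - t)), (pow2_ge_0 (t * y)); lra|].
    assert (t * (1 + y ^ 2) < 1)%R.
    { apply Rlt_le_trans with (/ (1 + y ^ 2) * (1 + y ^ 2))%R.
      - apply Rmult_lt_compat_r; lra.
      - right; field; lra. }
    nra. }
assert (Him : Im kap = 0%R).
{ destruct (Req_dec (Im kap) 0) as [E|E]; [exact E|exfalso].
  (* For this y the left side of [Key] equals 1. *)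
  assert (H := Key (- (Re kap + 1) / Im kap)%R).
  replace (- Re kap - - (Re kap + 1) / Im kap * Im kap)%R with 1%R in H by (field; exact E).
  lra. }
exists (Re kap); split.
- generalize (Key 0%R); lra.
- replace (RtoC (Re kap)) with kap.
  + unfold kap; field; exact Hp.
  + destruct kap as [k1 k2]; simpl in *; rewrite Him; reflexivity.
Qed.

Lemma quadratic_form_ge_0 (L M N x : R) :
  (0 <= L)%R -> (0 <= N)%R -> (0 <= L * N - M ^ 2)%R ->
  (0 <= L * x ^ 2 - 2 * M * x + N)%R.
Proof.
intros HL HN H; destruct (Req_dec L 0) as [E|E].
- assert (M = 0)%R by (subst; nra); subst; nra.
- apply Rmult_le_reg_l with L; [lra|].
  rewrite Rmult_0_r.
  replace (L * (L * x ^ 2 - 2 * M * x + N))%R with ((L * x - M) ^ 2 + (L * N - M ^ 2))%R by ring.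
  generalize (pow2_ge_0 (L * x - M)); lra.
Qed.

Lemma Cis_mul_neg (lam : R) : Cis (- lam) * Cis lam = 1.
Proof.
unfold Cis; rewrite cos_neg, sin_neg; apply injective_projections; simpl.
- generalize (sin2_cos2 lam); unfold Rsqr; lra.
- ring.
Qed.

Lemma Cconj_Cis_neg (lam : R) : Cconj (Cis (- lam)) = Cis lam.
Proof.
unfold Cis, Cconj; rewrite cos_neg, sin_neg; apply injective_projections; simpl; ring.
Qed.

Lemma Cis_neg_double (lam : R) : Cis (- (2 * lam)) = Cis (- lam) * Cis (- lam).
Proof.
unfold Cis; rewrite !cos_neg, !sin_neg, cos_2a, sin_2a.
apply injective_projections; simpl; ring.
Qed.

Lemma Cis_neq_0 (t : R) : Cis t <> 0.
Proof.
intros E; assert (H := Cis_mul_neg t); rewrite E, Cmult_0_r in H.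
apply RtoC_inj in H; lra.
Qed.

(** With [Cis (- lam)] as the inverse of [Cis lam], this makes the boundary identity rational in
    [Cis lam], where [field] can decide it. *)
Lemma cos_Cis (lam : R) : RtoC (cos lam) = (1 + Cis lam * Cis lam) / (2 * Cis lam).
Proof.
assert (H := Cis_neq_0 lam).
transitivity ((Cis (- lam) + Cis lam) / 2).
- unfold Cis; rewrite cos_neg, sin_neg.
  apply injective_projections; simpl; field.
- rewrite <- (Cis_mul_neg lam); field; exact H.
Qed.

(* With [q = z F'/F] the boundary point of the half-plane is
   [q = cos lam e^(i lam) (i x - 1)], and [k - 1] is Jack's multiplier. *)
Lemma boundary_quadratic (lam x k : R) (a b : C) : (0 < cos lam)%R ->
  let q := cos lam * Cis lam * (Ci * x - 1) in
  let S := q * q + (a + b) * q - k * (cos lam * Cis lam) / 2 * (1 + x * x) in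
  (2 * Re (Cconj (a * b) * S) + Cmod (a * b) ^ 2 =
   - cos lam * (coefL lam a b * x ^ 2 - 2 * coefM lam a b * x + coefN lam a b
     + (k - 1) * Re (Cis (- lam) * (a * b))%C * (1 + x ^ 2)))%R.
Proof.
intros Hc q S.
assert (Hw := Cis_neq_0 lam).
assert (Hcc : RtoC (cos lam) <> 0) by (apply RtoC_neq_0; lra).
assert (Hsw : Cis (- lam) = / Cis lam).
{ rewrite <- (Cmult_1_r (/ Cis lam)), <- (Cis_mul_neg lam); field; exact Hw. }
assert (Hcw : Cconj (/ Cis lam) = Cis lam) by (rewrite <- Hsw; apply Cconj_Cis_neg).
assert (Hcw' : Cconj (Cis lam) = / Cis lam) by (rewrite <- Hcw, Cconj_conj, Hcw; reflexivity).
set (ZL := Cis (- lam) * (a * b) * (2 + Cis (- (2 * lam)))).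
set (ZM := Cis (- lam) * (a * b) * (Cconj a + Cconj b - 2 * Cis (- lam) * cos lam)).
set (ZN := Cis (- lam) * (a * b) *
      (2 * Cconj a + 2 * Cconj b - Cis (- (2 * lam))
       - Cis lam * (Cconj a * Cconj b) / cos lam)).
change (coefL lam a b) with (Re ZL); change (coefM lam a b) with (Im ZM).
change (coefN lam a b) with (Re ZN).
set (W := Cis (- lam) * (a * b)).
set (A := a * b) in *.
assert (HA : (Cmod A ^ 2 = Re (Cconj A * A))%R) by apply Cmod2_dot.
rewrite HA.
transitivity (Re (2 * (Cconj A * S) + Cconj A * A)).
{ destruct (Cconj A * S), (Cconj A * A); simpl; ring. }
(* Everything is conjugated, which leaves Re unchanged and gives Im ZM = Re (i conj ZM): the
   conjugates share the factor [Cconj A] and are otherwise rational in a, b and [Cis lam]. *)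
transitivity (Re (- cos lam * (Cconj ZL * (x * x) - 2 * Ci * x * Cconj ZM + Cconj ZN
   + (k - 1) * Cconj W * (1 + x * x)))).
2:{ destruct ZL, ZM, ZN, W; simpl; ring. }
f_equal.
assert (HconjR : forall r : R, Cconj (RtoC r) = r)
  by (intros r; apply injective_projections; simpl; ring).
assert (EL : Cconj ZL = Cis lam * Cconj A * (2 + Cis lam * Cis lam)).
{ unfold ZL; fold A.
  rewrite Cis_neg_double, Hsw, !Cmult_conj, Cplus_conj, !Cmult_conj, Hcw, HconjR; reflexivity. }
assert (EM : Cconj ZM = Cis lam * Cconj A * (a + b - 2 * Cis lam * cos lam)).
{ unfold ZM; fold A.
  rewrite Hsw, !Cmult_conj, Cminus_conj, Cplus_conj, !Cmult_conj, !Cconj_conj, Hcw, !HconjR; reflexivity. }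
assert (EN : Cconj ZN = Cis lam * Cconj A * (2 * a + 2 * b - Cis lam * Cis lam
   - / Cis lam * A / cos lam)).
{ unfold ZN; fold A.
  rewrite Cis_neg_double, Hsw, !Cmult_conj, !Cminus_conj, Cplus_conj, Cdiv_conj by exact Hcc.
  rewrite !Cmult_conj, !Cconj_conj, Hcw, Hcw', !HconjR; unfold A; ring. }
assert (EW : Cconj W = Cis lam * Cconj A)
  by (unfold W; rewrite Cmult_conj, Hsw, Hcw; reflexivity).
rewrite EL, EM, EN, EW; unfold S, q.
assert (HCi : Ci * Ci = - (1)) by (apply injective_projections; simpl; ring).
assert (Hne : 1 + Cis lam * Cis lam <> 0).
{ intros E; apply Hcc; rewrite cos_Cis, E; unfold Cdiv; ring. }
(* Expanded by hand to expose [Ci * Ci], whose value -1 is not a field identity. *)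
assert (HE : 2 * (Cconj A * (cos lam * Cis lam * (Ci * x - 1) * (cos lam * Cis lam * (Ci * x - 1)) +
      (a + b) * (cos lam * Cis lam * (Ci * x - 1)) -
      k * (cos lam * Cis lam) / 2 * (1 + x * x))) + Cconj A * A =
  Cconj A * (2 * (cos lam * Cis lam) * (cos lam * Cis lam) * ((Ci * Ci) * (x * x) - 2 * Ci * x + 1)
    + 2 * (a + b) * (cos lam * Cis lam) * (Ci * x - 1)
    - k * (cos lam * Cis lam) * (1 + x * x) + A)) by (field; apply RtoC_neq_0; lra).
rewrite HE, HCi, cos_Cis.
field; repeat split; try assumption; apply RtoC_neq_0; lra.
Qed.

(** * Positivity of the spirallikeness form *)

Section HypergeometricODE.

Variables (lam : R) (a b : C) (F F1 F2 F3 : C -> C).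
Hypothesis dF : forall z, (Cmod z < 1)%R -> quad_deriv F z (F1 z).
Hypothesis dF1 : forall z, (Cmod z < 1)%R -> quad_deriv F1 z (F2 z).
Hypothesis dF2 : forall z, (Cmod z < 1)%R -> quad_deriv F2 z (F3 z).
Hypothesis F_0 : F 0 = 1.
Hypothesis ode : forall z, (Cmod z < 1)%R ->
  (1 - z) * (z * F2 z + (a + b + 1) * F1 z) = a * b * F z.
Hypothesis Hcos : (0 < cos lam)%R.

Let w := Cis (- lam).
Let N (z : C) := w * F1 z.
Let D (z : C) := 2 * cos lam * F z + z * N z.
Let N1 (z : C) := w * F2 z.
Let D1 (z : C) := 2 * cos lam * F1 z + (N z + z * N1 z).

(** For f = z F this is |F|^2 Re (e^(-i lam) z f'/f), but it needs no F z <> 0. *)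
Definition spiral_form (z : C) : R := Re (w * (F z + z * F1 z) * Cconj (F z)).

Let Re_w : Re w = cos lam.
Proof. unfold w, Cis; simpl; apply cos_neg. Qed.

Let w_neq_0 : w <> 0.
Proof. apply Cis_neq_0. Qed.

(** Polarization: with X = z N, |2 cos lam F + X|^2 - |X|^2 = 4 cos lam Re ((cos lam F + X) conj F),
    and cos lam |F|^2 = Re (w F conj F). A positive form thus says |z N| < |D|, with nothing
    divided. *)
Lemma spiral_form_eq (z : C) :
  (4 * cos lam * spiral_form z = Cmod (D z) ^ 2 - Cmod (z * N z) ^ 2)%R.
Proof.
unfold spiral_form; rewrite !Cmod2_alt.
replace (w * (F z + z * F1 z) * Cconj (F z)) with
  ((w * F z + z * N z) * Cconj (F z)) by (unfold N; ring).
unfold D; rewrite <- Re_w; generalize (z * N z); intros x.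
destruct w, (F z), x; simpl; ring.
Qed.

Let dN (z : C) : (Cmod z < 1)%R -> quad_deriv N z (N1 z).
Proof.
intros Hz; eapply quad_deriv_eq.
- apply quad_deriv_mult; [apply quad_deriv_const|apply dF1, Hz].
- unfold N1; ring.
Qed.

Let dD (z : C) : (Cmod z < 1)%R -> quad_deriv D z (D1 z).
Proof.
intros Hz; eapply quad_deriv_eq.
- apply quad_deriv_plus; apply quad_deriv_mult.
  + apply quad_deriv_const.
  + apply dF, Hz.
  + apply quad_deriv_id.
  + apply dN, Hz.
- unfold D1; ring.
Qed.

Let dN1 (z : C) : (Cmod z < 1)%R -> quad_deriv N1 z (w * F3 z).
Proof.
intros Hz; eapply quad_deriv_eq.
- apply quad_deriv_mult; [apply quad_deriv_const|apply dF2, Hz].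
- cbv beta; ring.
Qed.

Let dD1 (z : C) : (Cmod z < 1)%R ->
  quad_deriv D1 z (2 * cos lam * F2 z + (N1 z + (N1 z + z * (w * F3 z)))).
Proof.
intros Hz; eapply quad_deriv_eq.
- apply quad_deriv_plus; [apply quad_deriv_mult|apply quad_deriv_plus; [|apply quad_deriv_mult]].
  + apply quad_deriv_const.
  + apply dF1, Hz.
  + apply dN, Hz.
  + apply quad_deriv_id.
  + apply dN1, Hz.
- cbv beta; ring.
Qed.

Let psi (z : C) := N z * / D z.
Let psi1 (z : C) := N1 z * / D z + N z * (- D1 z / (D z * D z)).

Let dpsi (z : C) : (Cmod z < 1)%R -> D z <> 0 -> quad_deriv psi z (psi1 z).
Proof.
intros Hz HD.
apply (quad_deriv_mult N (fun v => / D v)); [apply dN, Hz|].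
apply quad_deriv_inv; [apply dD, Hz|exact HD].
Qed.

(** The maximum principle differentiates [psi] twice; since [psi1] already contains F'', this is
    where [F3] enters. *)
Let dpsi1 (z : C) : (Cmod z < 1)%R -> D z <> 0 -> exists l, quad_deriv psi1 z l.
Proof.
intros Hz HD; eexists; unfold psi1, Cdiv, Cminus.
assert (HDD : D z * D z <> 0) by (apply Cmult_neq_0; exact HD).
apply quad_deriv_plus.
- apply (quad_deriv_mult N1 (fun v => / D v)); [apply dN1, Hz|].
  apply quad_deriv_inv; [apply dD, Hz|exact HD].
- apply (quad_deriv_mult N (fun v => - D1 v * / (D v * D v))); [apply dN, Hz|].
  apply (quad_deriv_mult (fun v => - D1 v) (fun v => / (D v * D v))).
  + apply (quad_deriv_ext (fun v => (- (1)) * D1 v)); [intros v; ring|].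
    apply quad_deriv_mult; [apply quad_deriv_const|apply dD1, Hz].
  + apply (quad_deriv_inv (fun v => D v * D v)); [|exact HDD].
    apply quad_deriv_mult; apply dD, Hz.
Qed.

Let spiral_form_cont (z : C) : (Cmod z < 1)%R ->
  forall e : R, (0 < e)%R -> exists d : R, (0 < d)%R /\
    forall v : C, (Cmod (v - z) < d)%R -> (Rabs (spiral_form v - spiral_form z) < e)%R.
Proof.
intros Hz e He.
assert (He2 : (0 < 2 * cos lam * e)%R) by (apply Rmult_lt_0_compat; lra).
assert (Q : quad_deriv (fun v => v * N v) z (1 * N z + z * N1 z))
  by (apply quad_deriv_mult; [apply quad_deriv_id|apply dN, Hz]).
destruct (Cmod_continuous_sqr D z (quad_deriv_cont _ _ _ (dD z Hz)) _ He2) as [d [Hd Cd]].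
destruct (Cmod_continuous_sqr (fun v => v * N v) z (quad_deriv_cont _ _ _ Q) _ He2) as [d' [Hd' Cd']].
exists (Rmin d d'); split; [apply Rmin_glb_lt; assumption|].
intros v Hv.
assert (A1 := Cd v (Rlt_le_trans _ _ _ Hv (Rmin_l _ _))).
assert (A2 := Cd' v (Rlt_le_trans _ _ _ Hv (Rmin_r _ _))).
apply Rabs_def2 in A1; apply Rabs_def2 in A2.
assert (B1 := spiral_form_eq v); assert (B2 := spiral_form_eq z).
apply Rabs_def1; apply Rmult_lt_reg_l with (4 * cos lam)%R; lra.
Qed.

(** * A point of least modulus where the form is not positive *)

Section FirstZero.

Variable z0 : C.
Hypothesis Hz0 : (Cmod z0 < 1)%R.
Hypothesis Hneg : (spiral_form z0 <= 0)%R.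
Hypothesis Hpos : forall z, (Cmod z < Cmod z0)%R -> (0 < spiral_form z)%R.

Let z0_neq_0 : z0 <> 0.
Proof.
intros E; rewrite E in Hneg; unfold spiral_form in Hneg; rewrite F_0 in Hneg.
replace (w * (1 + 0 * F1 0) * Cconj 1) with w in Hneg
  by (apply injective_projections; simpl; ring).
rewrite Re_w in Hneg; lra.
Qed.

Let r0_pos : (0 < Cmod z0)%R.
Proof. apply Cmod_gt_0, z0_neq_0. Qed.

Let D_neq_0 (z : C) : (Cmod z < Cmod z0)%R -> D z <> 0.
Proof.
intros Hz E.
assert (H := Hpos z Hz); assert (H1 := spiral_form_eq z).
rewrite E, Cmod_0 in H1.
assert (0 < 4 * cos lam * spiral_form z)%R by (apply Rmult_lt_0_compat; lra).
generalize (pow2_ge_0 (Cmod (z * N z))); lra.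
Qed.

(* Schwarz' lemma for [z psi], which maps the disk of radius [|z0|] into the
   unit disk. *)
Let schwarz (z : C) : (Cmod z < Cmod z0)%R -> (Cmod (psi z) <= / Cmod z0)%R.
Proof.
intros Hz; apply Rnot_lt_le; intros Hgt.
assert (Hp : (0 < Cmod (psi z))%R).
{ eapply Rlt_trans; [|exact Hgt]; apply Rinv_0_lt_compat, r0_pos. }
assert (Hi : (/ Cmod (psi z) < Cmod z0)%R).
{ rewrite <- (Rinv_inv (Cmod z0)); apply Rinv_lt_contravar; [|exact Hgt].
  apply Rmult_lt_0_compat; [apply Rinv_0_lt_compat, r0_pos|exact Hp]. }
(* The radius r will lie above both |z| and 1/|psi z| and below |z0|. On its circle r |N| <= |D|, so
   the maximum principle gives |psi z| <= 1/r < |psi z|. *)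
set (m := Rmax (Cmod z) (/ Cmod (psi z))).
assert (Hm : (m < Cmod z0)%R) by (apply Rmax_lub_lt; assumption).
assert (Hm1 : (Cmod z <= m)%R) by apply Rmax_l.
assert (Hm2 : (/ Cmod (psi z) <= m)%R) by apply Rmax_r.
assert (Hip : (0 < / Cmod (psi z))%R) by (apply Rinv_0_lt_compat, Hp).
set (r := ((m + Cmod z0) / 2)%R).
assert (Hr : (0 < r < Cmod z0)%R) by (unfold r; lra).
assert (H : (Cmod (psi z) <= / r)%R).
{ apply (maximum_principle psi psi1 (Cmod z0) r (/ r)); try assumption.
  - intros v Hv; apply dpsi; [lra|apply D_neq_0, Hv].
  - intros v Hv; apply dpsi1; [lra|apply D_neq_0, Hv].
  - intros v Hv.
    assert (HD := D_neq_0 v ltac:(lra)).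
    assert (HDp : (0 < Cmod (D v))%R) by (apply Cmod_gt_0, HD).
    assert (H1 := spiral_form_eq v); assert (H2 := Hpos v ltac:(lra)).
    assert (0 < 4 * cos lam * spiral_form v)%R by (apply Rmult_lt_0_compat; lra).
    unfold psi; rewrite Cmod_mult, Cmod_inv by exact HD.
    rewrite Cmod_mult, Hv in H1.
    assert (H3 := Cmod_ge_0 (N v)).
    assert (H4 : (r * Cmod (N v) <= Cmod (D v))%R) by nra.
    apply Rmult_le_reg_r with (r * Cmod (D v))%R; [apply Rmult_lt_0_compat; lra|].
    field_simplify; lra.
  - unfold r; lra. }
assert (H5 : (r <= / Cmod (psi z))%R).
{ rewrite <- (Rinv_inv r); apply Rinv_le_contravar; assumption. }
unfold r in H5; lra.
Qed.

(** The form is positive at the points (1 - s) z0 with small s > 0, so continuity excludes a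
    negative value at z0. *)
Let form_0 : spiral_form z0 = 0%R.
Proof.
destruct (Rle_lt_or_eq_dec _ _ Hneg) as [Hlt|E]; [exfalso|exact E].
destruct (spiral_form_cont z0 Hz0 (- spiral_form z0)%R) as [d [Hd H]]; [lra|].
set (s := Rmin 1 (d / 2)).
assert (Hs : (0 < s <= 1)%R).
{ split; [apply Rmin_glb_lt; lra|apply Rmin_l]. }
assert (Hsd : (s <= d / 2)%R) by apply Rmin_r.
assert (H1 : (0 < spiral_form (RtoC (1 - s) * z0)%C)%R).
{ apply Hpos; rewrite Cmod_mult, Cmod_R, Rabs_right by lra; nra. }
assert (H2 : (Rabs (spiral_form (RtoC (1 - s) * z0)%C - spiral_form z0) < - spiral_form z0)%R).
{ apply H; replace (RtoC (1 - s) * z0 - z0) with (RtoC (- s) * z0)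
    by (rewrite RtoC_minus, RtoC_opp; ring).
  rewrite Cmod_mult, Cmod_R, Rabs_left by lra; nra. }
apply Rabs_def2 in H2; lra.
Qed.

Let D_z0 : D z0 <> 0 -> Cmod (psi z0) = (/ Cmod z0)%R.
Proof.
intros HD.
assert (H := spiral_form_eq z0); rewrite form_0, Rmult_0_r in H.
assert (HDp : (0 < Cmod (D z0))%R) by (apply Cmod_gt_0, HD).
rewrite Cmod_mult in H.
assert (H1 := Cmod_ge_0 (N z0)).
assert (H2 : Cmod (D z0) = (Cmod z0 * Cmod (N z0))%R).
{ apply Rsqr_inj; [lra|apply Rmult_le_pos; lra|unfold Rsqr; lra]. }
unfold psi; rewrite Cmod_mult, Cmod_inv by exact HD.
assert (H3 : Cmod (N z0) <> 0%R) by (intros E; rewrite E, Rmult_0_r in H2; lra).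
rewrite H2; field; split; lra.
Qed.

(** [boundary_maximum] for [psi], whose modulus attains the Schwarz bound at z0, multiplied by D^2.
    No quotient by F occurs, so it also applies at a zero of F. *)
Let jack : D z0 <> 0 -> exists k : R, (0 <= k)%R /\
  z0 * (N1 z0 * D z0 - N z0 * D1 z0) = k * N z0 * D z0.
Proof.
intros HD.
assert (HE := D_z0 HD).
assert (Hp : psi z0 <> 0).
{ apply Cmod_gt_0; rewrite HE; apply Rinv_0_lt_compat, r0_pos. }
destruct (boundary_maximum psi z0 (psi1 z0)) as [k [Hk Ek]]; try assumption.
- apply dpsi; assumption.
- intros z Hz; rewrite HE; apply schwarz, Hz.
- exists k; split; [exact Hk|].
  transitivity (z0 * psi1 z0 * (D z0 * D z0)).
  + unfold psi1; field; exact HD.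
  + rewrite Ek; unfold psi; field; exact HD.
Qed.

(* Gronwall's inequality on the segment from [z0 / 2] to [z0]. *)
Let no_double_zero : F z0 = 0 -> F1 z0 <> 0.
Proof.
intros HF HF1.
set (c := a + b + 1).
(* The differential equation is solved for F'': |1 - z| >= 1 - |z0|, and starting the segment at
   z0/2 keeps |z| >= |z0|/2. *)
set (C1 := ((Cmod (a * b)%C / (1 - Cmod z0) + Cmod c) / (Cmod z0 / 2))%R).
assert (HC0 : (0 <= Cmod (a * b)%C / (1 - Cmod z0))%R).
{ apply Rmult_le_pos; [apply Cmod_ge_0|left; apply Rinv_0_lt_compat; lra]. }
assert (HC1 : (0 <= C1)%R).
{ apply Rmult_le_pos; [|left; apply Rinv_0_lt_compat; lra].
  generalize (Cmod_ge_0 c); lra. }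
assert (Hin : forall t : R, (1 / 2 <= t <= 1)%R ->
  Cmod (0 + t * z0) = (t * Cmod z0)%R).
{ intros t Ht; rewrite Cplus_0_l, Cmod_mult, Cmod_R, Rabs_right by lra; reflexivity. }
assert (HF2 : forall t : R, (1 / 2 <= t <= 1)%R -> let z := 0 + t * z0 in
  (Cmod (F2 z) <= C1 * (Cmod (F z) + Cmod (F1 z)))%R).
{ intros t Ht z.
  assert (Hz : Cmod z = (t * Cmod z0)%R) by (apply Hin, Ht).
  assert (Hz1 : (Cmod z < 1)%R) by nra.
  assert (Hz2 : (Cmod z <= Cmod z0)%R) by nra.
  assert (Hz3 : (Cmod z0 / 2 <= Cmod z)%R) by nra.
  assert (H1z : (1 - Cmod z0 <= Cmod (1 - z))%R).
  { assert (Ht' := Cmod_triangle (1 - z) z); replace (1 - z + z) with (RtoC 1) in Ht' by ring.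
    rewrite Cmod_1 in Ht'; lra. }
  assert (H1z0 : 1 - z <> 0) by (apply Cmod_gt_0; lra).
  assert (E : z * F2 z = a * b / (1 - z) * F z + - (c * F1 z)).
  { assert (Ho := ode z Hz1); fold c in Ho.
    transitivity ((1 - z) * (z * F2 z + c * F1 z) / (1 - z) - c * F1 z);
      [field; exact H1z0|rewrite Ho; field; exact H1z0]. }
  apply (f_equal Cmod) in E; rewrite Cmod_mult in E.
  assert (E2 : (Cmod z * Cmod (F2 z) <= Cmod (a * b)%C / (1 - Cmod z0) * Cmod (F z) + Cmod c * Cmod (F1 z))%R).
  { rewrite E; eapply Rle_trans; [apply Cmod_triangle|].
    rewrite Cmod_opp, !(Cmod_mult _ (F _)), !(Cmod_mult _ (F1 _)), Cmod_div by exact H1z0.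
    apply Rplus_le_compat_r, Rmult_le_compat_r; [apply Cmod_ge_0|].
    apply Rmult_le_compat_l; [apply Cmod_ge_0|apply Rinv_le_contravar; lra]. }
  assert (HfF := Cmod_ge_0 (F z)); assert (HfF1 := Cmod_ge_0 (F1 z)); assert (HfF2 := Cmod_ge_0 (F2 z)).
  assert (Hcc := Cmod_ge_0 c).
  apply Rmult_le_reg_l with (Cmod z0 / 2)%R; [lra|].
  replace (Cmod z0 / 2 * (C1 * (Cmod (F z) + Cmod (F1 z))))%R with
    ((Cmod (a * b)%C / (1 - Cmod z0) + Cmod c) * (Cmod (F z) + Cmod (F1 z)))%R
    by (unfold C1; field; lra).
  assert (Cmod z0 / 2 * Cmod (F2 z) <= Cmod z * Cmod (F2 z))%R by (apply Rmult_le_compat_r; lra).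
  set (K := (Cmod (a * b)%C / (1 - Cmod z0))%R) in *.
  assert (0 <= K * Cmod (F1 z))%R by (apply Rmult_le_pos; assumption).
  assert (0 <= Cmod c * Cmod (F z))%R by (apply Rmult_le_pos; assumption).
  lra. }
set (p := fun t : R => 0 + t * z0).
(* Along the segment 2 |F| |F'| <= u and 2 |F''| |F'| <= 4 C1 u, so this K has room to spare. *)
set (K := (2 + 4 * C1)%R).
set (u := fun t => (Re (Cconj (F (p t)) * F (p t)) + Re (Cconj (F1 (p t)) * F1 (p t)))%R).
set (u' := fun t => (Re (Cconj (z0 * F1 (p t)) * F (p t) + Cconj (F (p t)) * (z0 * F1 (p t)))
   + Re (Cconj (z0 * F2 (p t)) * F1 (p t) + Cconj (F1 (p t)) * (z0 * F2 (p t))))%R).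
assert (du : forall t, (1 / 2 <= t <= 1)%R -> is_derive u t (u' t)).
{ intros t Ht.
  assert (Hz1 : (Cmod (0 + t * z0) < 1)%R) by (rewrite Hin by exact Ht; nra).
  assert (Q0 := quad_deriv_line F 0 z0 _ t (dF _ Hz1)).
  assert (Q1 := quad_deriv_line F1 0 z0 _ t (dF1 _ Hz1)).
  apply (is_derive_plus (V := R_NormedModule)).
  - apply (curve_deriv_dot _ _ _ _ _ Q0 Q0).
  - apply (curve_deriv_dot _ _ _ _ _ Q1 Q1). }
assert (Hu' : forall t, (1 / 2 <= t <= 1)%R -> (0 <= u' t + K * u t)%R).
{ intros t Ht.
  assert (HT := HF2 t Ht); simpl in HT; fold (p t) in HT.
  assert (Hre : forall x y : C, (- (2 * (Cmod x * Cmod y)) <= Re (Cconj x * y + Cconj y * x))%R).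
  { intros x y.
    assert (H := re_le_Cmod (Cconj x * y + Cconj y * x)).
    assert (H' := Cmod_triangle (Cconj x * y) (Cconj y * x)).
    rewrite !Cmod_mult, !Cmod_conj in H'.
    assert (H'' := Rabs_le_between (Re (Cconj x * y + Cconj y * x)) (Cmod x * Cmod y + Cmod y * Cmod x)).
    destruct H'' as [H'' _]; specialize (H'' (Rle_trans _ _ _ H H')); lra. }
  assert (R1 := Hre (z0 * F1 (p t)) (F (p t))).
  assert (R2 := Hre (z0 * F2 (p t)) (F1 (p t))).
  rewrite Cmod_mult in R1, R2.
  unfold u', u; rewrite <- !Cmod2_dot.
  set (x := Cmod (F (p t))) in *; set (y := Cmod (F1 (p t))) in *; set (v := Cmod (F2 (p t))) in *.
  assert (Hx : (0 <= x)%R) by apply Cmod_ge_0.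
  assert (Hy : (0 <= y)%R) by apply Cmod_ge_0.
  assert (Hv : (0 <= v)%R) by apply Cmod_ge_0.
  assert (Hxy : (0 <= x * y)%R) by (apply Rmult_le_pos; assumption).
  assert (Hvy : (0 <= v * y)%R) by (apply Rmult_le_pos; assumption).
  assert (T1 : (Cmod z0 * y * x <= x * y)%R) by nra.
  assert (T2 : (Cmod z0 * v * y <= v * y)%R) by nra.
  assert (T3 : (v * y <= C1 * (x + y) * y)%R) by (apply Rmult_le_compat_r; assumption).
  assert (T4 : (x * y <= (x ^ 2 + y ^ 2) / 2)%R) by (generalize (pow2_ge_0 (x - y)); nra).
  assert (T5 : (C1 * ((x + y) * y) <= C1 * (2 * (x ^ 2 + y ^ 2)))%R).
  { apply Rmult_le_compat_l; [exact HC1|]; generalize (pow2_ge_0 x); nra. }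
  unfold K; nra. }
(* By [Hu'] the function u e^(K t) does not decrease. As it vanishes at 1, u is at most 0 at 1/2;
   then F (z0/2) = 0, against the positivity of the form there. *)
destruct (MVT_cor2 (fun t => u t * exp (K * t))%R
  (fun t => u' t * exp (K * t) + u t * (K * exp (K * t)))%R (1 / 2) 1) as [x [Hx1 Hx2]]; [lra| |].
{ intros t Ht; apply is_derive_Reals.
  evar_last.
  - apply (is_derive_mult u (fun s => exp (K * s)) t (u' t) (K * exp (K * t))%R).
    + apply du, Ht.
    + auto_derive; [exact I|ring].
    + apply Rmult_comm.
  - reflexivity. }
assert (Hz1 : p 1%R = z0) by (unfold p; ring).
assert (Hu1 : u 1%R = 0%R) by (unfold u; rewrite Hz1, HF, HF1; simpl; ring).
rewrite Hu1, Rmult_0_l in Hx1.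
assert (Hge : (0 <= (u' x + K * u x) * exp (K * x))%R).
{ apply Rmult_le_pos; [apply Hu'; lra|left; apply exp_pos]. }
assert (Hu2 : (u (1 / 2) <= 0)%R).
{ apply Rmult_le_reg_r with (exp (K * (1 / 2))); [apply exp_pos|]; lra. }
assert (Hlt : (Cmod (p (1 / 2)%R) < Cmod z0)%R).
{ unfold p; rewrite Hin; lra. }
assert (Hfin := Hpos _ Hlt).
assert (HFp : F (p (1 / 2)%R) = 0).
{ apply Cmod_eq_0; unfold u in Hu2; rewrite <- !Cmod2_dot in Hu2.
  generalize (Cmod_ge_0 (F (p (1 / 2)%R))), (pow2_ge_0 (Cmod (F1 (p (1 / 2)%R)))); nra. }
unfold spiral_form in Hfin; rewrite HFp in Hfin.
replace (w * (0 + p (1 / 2)%R * F1 (p (1 / 2)%R)) * Cconj 0) with (RtoC 0) in Hfin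
  by (apply injective_projections; simpl; ring).
simpl in Hfin; lra.
Qed.

(** At a simple zero D = z0 N, and the terms with F'' cancel in Jack's relation, which shrinks to (k
    + 1) w + 2 cos lam = 0; its real part (k + 3) cos lam is positive. *)
Let F_z0 : F z0 <> 0.
Proof.
intros HF; assert (HF1 := no_double_zero HF).
assert (HDz : D z0 = z0 * N z0) by (unfold D; rewrite HF; ring).
assert (HD : D z0 <> 0).
{ rewrite HDz; unfold N; repeat apply Cmult_neq_0; auto using z0_neq_0, w_neq_0. }
destruct (jack HD) as [k [Hk Ek]].
rewrite HDz in Ek; unfold D1, N1, N in Ek.
assert (E : k * w + (2 * cos lam + w) = 0).
{ assert (Hne : z0 * w * F1 z0 * F1 z0 <> 0)
    by (repeat apply Cmult_neq_0; auto using z0_neq_0, w_neq_0).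
  assert (Hzero : (k * w + (2 * cos lam + w)) * (z0 * w * F1 z0 * F1 z0) = 0).
  { transitivity (k * (w * F1 z0) * (z0 * (w * F1 z0)) + z0 * w * F1 z0 * F1 z0 * (2 * cos lam + w));
      [ring|]; rewrite <- Ek; ring. }
  transitivity ((k * w + (2 * cos lam + w)) * (z0 * w * F1 z0 * F1 z0) / (z0 * w * F1 z0 * F1 z0)).
  - field; repeat split; auto using z0_neq_0, w_neq_0.
  - rewrite Hzero; unfold Cdiv; ring. }
apply (f_equal Re) in E.
assert (HR : (Re (k * w + (2 * cos lam + w)) = k * Re w + (2 * cos lam + Re w))%R)
  by (destruct w; simpl; ring).
rewrite HR, Re_w in E; simpl in E; nra.
Qed.

Hypothesis Hi : (0 <= Re (Cis (- lam) * (a * b))%C)%R.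
Hypothesis HL : (0 <= coefL lam a b)%R.
Hypothesis HN : (0 <= coefN lam a b)%R.
Hypothesis HLMN : (0 <= coefL lam a b * coefN lam a b - (coefM lam a b) ^ 2)%R.
Hypothesis Hab : a * b <> 0.

Lemma first_zero_absurd : False.
Proof.
assert (HF := F_z0).
assert (HD : D z0 <> 0).
{ intros E.
  assert (H := spiral_form_eq z0); rewrite form_0, E, Cmod_0 in H.
  assert (H0 : z0 * N z0 = 0).
  { apply Cmod_eq_0; generalize (Cmod_ge_0 (z0 * N z0)); nra. }
  unfold D in E; rewrite H0, Cplus_0_r in E.
  revert E; repeat apply Cmult_neq_0; auto; apply RtoC_neq_0; lra. }
destruct (jack HD) as [kap [Hkap Ek]].
assert (Hcc : RtoC (cos lam) <> 0) by (apply RtoC_neq_0; lra).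
set (q := z0 * F1 z0 / F z0).
set (y := z0 * z0 * F2 z0 / F z0).
assert (EF1 : F1 z0 = q * F z0 / z0) by (unfold q; field; auto using z0_neq_0).
assert (EF2 : F2 z0 = y * F z0 / (z0 * z0)) by (unfold y; field; auto using z0_neq_0).
(* Since z psi has the multiplier 1 + kap, z q' = (1 + kap) q (2 cos lam + w q)/(2 cos lam); here z
   q' = y + q - q^2. *)
assert (Ey : y = q * q - q + (1 + kap) * (q * (2 * cos lam + w * q)) / (2 * cos lam)).
{ unfold D, D1, N1, N in Ek; rewrite EF1, EF2 in Ek.
  assert (E : y * (2 * cos lam + w * q) - q * (2 * cos lam * q + w * q + w * y)
     = kap * q * (2 * cos lam + w * q)).
  { transitivity (z0 * (w * (y * F z0 / (z0 * z0)) * (2 * cos lam * F z0 + z0 * (w * (q * F z0 / z0))) -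
      w * (q * F z0 / z0) * (2 * cos lam * (q * F z0 / z0) +
       (w * (q * F z0 / z0) + z0 * (w * (y * F z0 / (z0 * z0)))))) * z0 / (w * F z0 * F z0)).
    - field; auto using z0_neq_0, w_neq_0.
    - rewrite Ek; field; auto using z0_neq_0, w_neq_0. }
  transitivity ((y * (2 * cos lam + w * q) - q * (2 * cos lam * q + w * q + w * y)
    + q * (2 * cos lam * q + w * q)) / (2 * cos lam)).
  - field; exact Hcc.
  - rewrite E; field; exact Hcc. }
(* The form vanishes at z0, so w q lies on the line of real part - cos lam; x is its height in units
   of cos lam. *)
assert (Hx : exists x : R, q = cos lam * Cis lam * (Ci * x - 1)).
{ assert (HP : Re (w * (1 + q)) = 0%R).
  { assert (H := form_0); unfold spiral_form in H; rewrite EF1 in H.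
    replace (w * (F z0 + z0 * (q * F z0 / z0)) * Cconj (F z0)) with
      (w * (1 + q) * RtoC (Cmod (F z0) ^ 2)) in H
      by (rewrite Cmod2_conj; field; apply z0_neq_0).
    assert (Hp : (0 < Cmod (F z0) ^ 2)%R) by (apply pow_lt, Cmod_gt_0, HF).
    assert (HR : (Re (w * (1 + q) * RtoC (Cmod (F z0) ^ 2)) = Re (w * (1 + q)) * Cmod (F z0) ^ 2)%R)
      by (destruct (w * (1 + q)); simpl; ring).
    rewrite HR in H; nra. }
  assert (HQ : Re (w * q) = (- cos lam)%R).
  { rewrite <- Re_w; destruct w, q; simpl in *; lra. }
  exists (Im (w * q) / cos lam)%R.
  assert (Ewq : w * q = RtoC (cos lam) * (Ci * RtoC (Im (w * q) / cos lam) - 1)).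
  { destruct (w * q) as [p s]; simpl in HQ; rewrite HQ.
    apply injective_projections; simpl; field; lra. }
  transitivity (Cis lam * (w * q)).
  - transitivity (w * Cis lam * q); [|ring].
    unfold w; rewrite Cis_mul_neg; ring.
  - rewrite Ewq at 1; ring. }
destruct Hx as [x Hx].
(* This is z q' + q^2 + (a + b) q at z0, with z q' evaluated on the boundary line. *)
set (S := q * q + (a + b) * q - (1 + kap)%R * (cos lam * Cis lam) / 2 * (1 + x * x)).
assert (ES : S = y + (a + b + 1) * q).
{ assert (Hwq : w * q = cos lam * (Ci * x - 1)).
  { rewrite Hx; transitivity (w * Cis lam * cos lam * (Ci * x - 1)); [ring|].
    unfold w; rewrite Cis_mul_neg; ring. }
  unfold S; rewrite Ey, Hwq, RtoC_plus.
  assert (Hm : q * (2 * cos lam + cos lam * (Ci * x - 1)) =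
    - (cos lam * cos lam * Cis lam * (1 + x * x))).
  { rewrite Hx.
    transitivity (cos lam * cos lam * Cis lam * ((Ci * Ci) * (x * x) - 1)); [ring|].
    replace (Ci * Ci) with (- RtoC 1) by (apply injective_projections; simpl; ring); ring. }
  rewrite Hm; field; exact Hcc. }
(* The equation (1 - z0) S = a b z0, arranged so that |z0| < 1 yields |S| < |a b + S|. *)
assert (Hode : z0 * (a * b + S) = S).
{ assert (Ho := ode z0 Hz0); rewrite EF1, EF2 in Ho.
  assert (E : (1 - z0) * S = a * b * z0).
  { rewrite ES.
    transitivity ((1 - z0) * (z0 * (y * F z0 / (z0 * z0)) + (a + b + 1) * (q * F z0 / z0)) * z0 / F z0).
    - field; auto using z0_neq_0.
    - rewrite Ho; field; exact HF. }
  transitivity (a * b * z0 + z0 * S); [ring|]; rewrite <- E; ring. }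
assert (Hlt : (0 < 2 * Re (Cconj (a * b) * S) + Cmod (a * b) ^ 2)%R).
(* Strictness rests on a b <> 0: if a b + S vanished, S would vanish too. *)
{ assert (HAS : a * b + S <> 0).
  { intros E; rewrite E, Cmult_0_r in Hode; rewrite <- Hode, Cplus_0_r in E; exact (Hab E). }
  assert (HASp : (0 < Cmod (a * b + S))%R) by (apply Cmod_gt_0, HAS).
  assert (HSl : (Cmod S < Cmod (a * b + S))%R).
  { rewrite <- Hode at 1; rewrite Cmod_mult; nra. }
  assert (HS0 := Cmod_ge_0 S).
  assert (Hsq : (Cmod S ^ 2 < Cmod (a * b + S) ^ 2)%R) by nra.
  rewrite !Cmod2_alt in *.
  destruct (a * b), S; simpl in *; lra. }
assert (HB := boundary_quadratic lam x (1 + kap)%R a b Hcos); cbv zeta in HB.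
rewrite <- Hx in HB; fold S in HB; rewrite HB in Hlt.
assert (HQ := quadratic_form_ge_0 _ _ _ x HL HN HLMN).
assert (H2 : (0 <= (1 + kap - 1) * Re (Cis (- lam) * (a * b)) * (1 + x ^ 2))%R).
{ apply Rmult_le_pos; [apply Rmult_le_pos; [lra|exact Hi]|generalize (pow2_ge_0 x); lra]. }
nra.
Qed.

End FirstZero.

(** The points of modulus at most |z| where positivity fails form a compact set; maximizing - |v|
    over it produces the point of least modulus that [first_zero_absurd] excludes. *)
Lemma spiral_form_pos :
  (0 <= Re (Cis (- lam) * (a * b))%C)%R -> (0 <= coefL lam a b)%R -> (0 <= coefN lam a b)%R ->
  (0 <= coefL lam a b * coefN lam a b - (coefM lam a b) ^ 2)%R -> a * b <> 0 ->
  forall z, (Cmod z < 1)%R -> (0 < spiral_form z)%R.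
Proof.
intros Hi HL HN HLMN Hab z Hz; apply Rnot_le_lt; intros Hneg.
destruct (compact_max (fun v => (Cmod v <= Cmod z)%R /\ (spiral_form v <= 0)%R)
  (fun v => (- Cmod v)%R) (Cmod z)) as [z0 [[Hz0 Hn0] Hmax]].
- exists z; split; [lra|exact Hneg].
- intros v [Hv _]; exact Hv.
- intros v Hv; destruct (Rle_lt_dec (Cmod v) (Cmod z)) as [Hle|Hgt].
  + assert (Hp : (0 < spiral_form v)%R) by (apply Rnot_le_lt; intros H; apply Hv; split; assumption).
    destruct (spiral_form_cont v ltac:(lra) _ Hp) as [d [Hd Cd]].
    exists d; split; [exact Hd|]; intros x Hx [_ Hx2].
    assert (A := Cd x Hx); apply Rabs_def2 in A; lra.
  + exists (Cmod v - Cmod z)%R; split; [lra|].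
    intros x Hx [Hx1 _].
    assert (Ht := Cmod_triangle x (- (x - v))).
    replace (x + - (x - v)) with v in Ht by ring; rewrite Cmod_opp in Ht; lra.
- intros v _ e He; exists e; split; [exact He|]; intros x Hx.
  assert (Ht := Cmod_triangle x (- (x - v))).
  replace (x + - (x - v)) with v in Ht by ring; rewrite Cmod_opp in Ht; lra.
- apply (first_zero_absurd z0); try assumption; [lra|].
  intros v Hv; apply Rnot_le_lt; intros Hv0.
  assert (H := Hmax v (conj (Rle_trans _ _ _ (Rlt_le _ _ Hv) Hz0) Hv0)); lra.
Qed.

End HypergeometricODE.

(** * From the positive form to spirallikeness *)

Lemma spirallike_of_form (lam : R) (F F1 : C -> C) :
  (0 < cos lam)%R -> F 0 = 1 ->
  (forall z, (Cmod z < 1)%R -> quad_deriv F z (F1 z)) ->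
  (forall z, (Cmod z < 1)%R -> (0 < spiral_form lam F F1 z)%R) ->
  spirallike lam (fun z => z * F z).
Proof.
intros Hcos HF0 dF Hpos.
assert (Hder : forall z, (Cmod z < 1)%R ->
  @is_derive C_AbsRing C_NormedModule (fun z => z * F z) z (F z + z * F1 z)).
{ intros z Hz; apply quad_deriv_is_derive; eapply quad_deriv_eq.
  - apply quad_deriv_mult; [apply quad_deriv_id|apply dF, Hz].
  - cbv beta; ring. }
assert (HF : forall z, (Cmod z < 1)%R -> F z <> 0).
{ intros z Hz E; assert (H := Hpos z Hz); unfold spiral_form in H; rewrite E in H.
  replace (Cis (- lam) * (0 + z * F1 z) * Cconj 0) with (RtoC 0) in H
    by (apply injective_projections; simpl; ring).
  simpl in H; lra. }
assert (H01 : (Cmod 0 < 1)%R) by (rewrite Cmod_0; lra).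
assert (Hd : forall z, (Cmod z < 1)%R -> C_derive (fun z => z * F z) z = F z + z * F1 z)
  by (intros z Hz; apply is_C_derive_unique, Hder, Hz).
split; [|split; [|split; [|split]]].
- intros z Hz; eexists; apply Hder, Hz.
- ring.
- rewrite (Hd 0 H01), HF0; ring.
- intros z Hz Hz0; apply Cmult_neq_0; auto.
- intros z Hz; unfold zf'_over_f; destruct (Ceq_dec z 0) as [E|E].
  + rewrite Cmult_1_r; simpl; rewrite cos_neg; exact Hcos.
  + rewrite (Hd z Hz).
    assert (Hp : (0 < Cmod (F z) ^ 2)%R) by (apply pow_lt, Cmod_gt_0, HF, Hz).
    assert (Hc : Cconj (F z) <> 0)
      by (apply Cmod_gt_0; rewrite Cmod_conj; apply Cmod_gt_0, HF, Hz).
    assert (Hi : (0 < / Cmod (F z) ^ 2)%R) by (apply Rinv_0_lt_compat, Hp).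
    replace (Cis (- lam) * (z * (F z + z * F1 z) / (z * F z))) with
      (Cis (- lam) * (F z + z * F1 z) * Cconj (F z) * RtoC (/ Cmod (F z) ^ 2)).
    2:{ rewrite RtoC_inv, Cmod2_conj by lra; field; auto using HF. }
    assert (H := Hpos z Hz); unfold spiral_form in H; revert H.
    generalize (Cis (- lam) * (F z + z * F1 z) * Cconj (F z)); intros [x y] H; simpl in *.
    rewrite Rmult_0_r, Rminus_0_r; apply Rmult_lt_0_compat; assumption.
Qed.

Theorem theorem1p4 (lam : R) (a b : C)
  (Hlam : (0 < Rabs lam < PI / 2)%R)
  (Hi : (0 <= Re (Cis (- lam) * (a * b))%C)%R)
  (HL : (0 <= coefL lam a b)%R)
  (HN : (0 <= coefN lam a b)%R)
  (HLMN : (0 <= coefL lam a b * coefN lam a b - (coefM lam a b) ^ 2)%R) :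
  spirallike lam (shifted_hyp2F1 a b (a + b + 1)%C).
Proof.
assert (Hcos : (0 < cos lam)%R).
{ destruct Hlam as [_ H]; apply Rabs_def2 in H; apply cos_gt_0; lra. }
assert (H01 : (Cmod 0 < 1)%R) by (rewrite Cmod_0; lra).
destruct (Ceq_dec (a * b) 0) as [Hab|Hab].
(* Here a + b + 1 may be 0 or a negative integer; F is constantly 1 and the form equals cos lam. *)
- assert (HF := fun z => hyp2F1_degenerate a b (a + b + 1) z Hab).
  apply (spirallike_of_form lam (hyp2F1 a b (a + b + 1)) (fun _ => 0)); auto.
  + intros z _; apply (quad_deriv_ext (fun _ => 1)); [intros v; symmetry; apply HF|].
    apply quad_deriv_const.
  + intros z _; unfold spiral_form; rewrite HF; simpl; rewrite cos_neg; lra.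
- assert (Hadm := parameter_admissible lam a b Hcos Hi HL HN Hab).
  set (u := hyp_coef a b (a + b + 1)).
  assert (U0 : unit_radius u) by (apply hyp_coef_unit_radius, Hadm).
  assert (U1 := unit_radius_derive _ U0).
  assert (U2 := unit_radius_derive _ U1).
  assert (HF0 : C_sum u 0 = 1).
  { rewrite C_sum_0; unfold u, hyp_coef; simpl.
    replace (1 * RtoC 1) with (RtoC 1) by ring; field; apply RtoC_neq_0; lra. }
  apply (spirallike_of_form lam (C_sum u) (C_sum (C_sum_derive u))); auto.
  + intros z Hz; apply C_sum_quad_deriv; assumption.
  + apply (spiral_form_pos lam a b _ _ (C_sum (C_sum_derive (C_sum_derive u)))
      (C_sum (C_sum_derive (C_sum_derive (C_sum_derive u))))); auto.
    * intros z Hz; apply C_sum_quad_deriv; assumption.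
    * intros z Hz; apply C_sum_quad_deriv; assumption.
    * intros z Hz; apply C_sum_quad_deriv; assumption.
    * intros z Hz; apply hyp_ode; assumption.
Qed.
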